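(* Fix $1\le p<2$. There exist constants $c_p,C_p>0$ depending only on $p$ such that for all integers $d\ge 2$ and $n\ge1$ there is a distribution over $r\times n$ real matrices $\Pi$ with $r\le C_p d^2$, every matrix in whose support has at most two non-zero entries per column, such that for every fixed $A\in\mathbb{R}^{n\times d}$, with probability at least $0.99$, simultaneously for all $x\in\mathbb{R}^d$, $$c_p\|Ax\|_p\le\|\Pi Ax\|_p\le C_p (d\log d)^{1/p}\|Ax\|_p.$$
   Context: $\|y\|_p=(\sum_i|y_i|^p)^{1/p}$. The distribution depends only on $n,d$ (and $p$), not on $A$. *)

(* Defs.v *)
From Stdlib Require Import Reals Lra.
Open Scope R_scope.

Fixpoint rsum (m : nat) (f : nat -> R) : R :=
  match m with
  | O => 0
  | S k => rsum k f + f k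
  end.

Definition powabs (t p : R) : R :=
  if Req_EM_T t 0 then 0 else Rpower (Rabs t) p.

Definition pnorm (p : R) (m : nat) (y : nat -> R) : R :=
  let s := rsum m (fun i => powabs (y i) p) in
  if Req_EM_T s 0 then 0 else Rpower s (1 / p).

Definition mulmv (k : nat) (M : nat -> nat -> R) (x : nat -> R) : nat -> R :=
  fun i => rsum k (fun j => M i j * x j).

Record prob_space := {
  ps_carrier :> Type;
  ps_meas : (ps_carrier -> Prop) -> Prop;
  ps_P : (ps_carrier -> Prop) -> R;
  ps_ext : forall E F : ps_carrier -> Prop,
      (forall w, E w <-> F w) -> ps_meas E -> ps_meas F /\ ps_P E = ps_P F;
  ps_full : ps_meas (fun _ => True);
  ps_compl : forall E, ps_meas E -> ps_meas (fun w => ~ E w);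
  ps_cunion : forall F : nat -> ps_carrier -> Prop,
      (forall k, ps_meas (F k)) -> ps_meas (fun w => exists k, F k w);
  ps_nonneg : forall E, ps_meas E -> 0 <= ps_P E;
  ps_total : ps_P (fun _ => True) = 1;
  ps_sigma_add : forall F : nat -> ps_carrier -> Prop,
      (forall k, ps_meas (F k)) ->
      (forall k l w, k <> l -> F k w -> F l w -> False) ->
      infinite_sum (fun k => ps_P (F k)) (ps_P (fun w => exists k, F k w))
}.

Definition random_var (S : prob_space) (X : S -> R) : Prop :=
  forall t : R, ps_meas S (fun w => X w <= t).

Definition col_sparse2 (r n : nat) (M : nat -> nat -> R) : Prop :=
  forall j, (j < n)%nat ->
  forall i1 i2 i3, (i1 < r)%nat -> (i2 < r)%nat -> (i3 < r)%nat ->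
    i1 <> i2 -> i1 <> i3 -> i2 <> i3 ->
    M i1 j = 0 \/ M i2 j = 0 \/ M i3 j = 0.

(* Main.v *)
Require Import Defs.
From Stdlib Require Import Reals.
From mathcomp Require all_boot all_order all_algebra.
From mathcomp Require perm boolp classical_sets reals sequences exp.
From mathcomp Require Rstruct Rstruct_topology.
From mathcomp Require ring lra zify.

(** Write [s = p / 2] and let [L ~ log d]. The sketch stacks two blocks: a CountSketch [S] with [O(d^2)] rows, scaled up by [(d L)^(1/p - 1/2)], and a CountSketch with [O(d L)] rows whose columns are dilated by independent [D_j] with [P(D_j^p > t) ~ 1/t].

Lower bound. A vector [y] of the column space with [||y||_p = 1] is either spiky, [||y||_2 >= (d L)^-(1/p - 1/2)] up to a constant, or has constant [l_p]-mass on coordinates with [|y_j|^p = O(1 / (d L))]. In the first case the first block suffices, because [S] preserves [l_2]-norms on the whole subspace and [||.||_p >= ||.||_2]. In the second case the second block fails with probability at most [exp (- C d L)], which survives a union bound over a net of size [d^O(d)].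

Upper bound. Take a basis whose rows [u_i] satisfy [sum_i ||u_i||_2^p <= d] and [||x||_2^p <= 12 ||U x||_p^p]; near-maximisers of a determinant provide one. For the second block the terms with [1 < ||u_i||^p D_i^p <= O(d)] contribute [O(d L)] in expectation and the smaller ones are controlled in [l_2]. For the first block, rows with [||u_i||^p > 1 / d] are at most [d^2] many, so that no bucket receives more than [O(d)] of them, and the other rows are again controlled in [l_2]. *)

(** Neither block suffices alone. A union bound over the net asks for failure probability
    [exp (- C d L)], but in the dilated block two equal coordinates already cancel with probability
    of order [1 / (d L)]. Spiky vectors therefore need a guarantee that holds on the whole subspace
    at once, and that is an l2 embedding, whose second-moment proof costs [d^2] rows.

    Passing from the net to the subspace uses the upper bound, so the spacing of the net depends on
    the number of rows of the second block, while that number depends on the size of the net. The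
    circle closes because the fineness is polynomial and the failure probability exponential in the
    row factor [M].

    The dilations are dyadic and cut off at level [n], where the lost mass is negligible, so that
    all randomness lives on finite types. The bases serve the analysis only and do not enter the
    matrices, which keeps the distribution independent of [A]. *)

Module SparseEmbedding.

Import all_boot all_order all_algebra.
Import perm boolp classical_sets reals sequences exp.
Import ring lra zify.
Set Implicit Arguments. Unset Strict Implicit. Unset Printing Implicit Defensive.
Import Order.TTheory GRing.Theory Num.Theory.
Local Open Scope ring_scope.

(** * Powers *)

Section Powers.
Variable R : realType.
Implicit Types (a b c s t x y : R).

Lemma powR_subadd s a b : 0 < s -> s <= 1 -> 0 <= a -> 0 <= b ->
  (a + b) `^ s <= a `^ s + b `^ s.
Proof.
move=> s0 s1 a0 b0.
have [ab0|abn0] := eqVneq (a + b) 0.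
  by rewrite ab0 powR0 ?gt_eqF// addr_ge0 ?powR_ge0.
have ab : 0 < a + b by rewrite lt_def abn0 addr_ge0.
have key c : 0 <= c -> c <= a + b -> c / (a + b) * (a + b) `^ s <= c `^ s.
  move=> c0 cab.
  have {2}-> : c = c / (a + b) * (a + b) by rewrite divfK.
  rewrite powRM ?divr_ge0 ?(ltW ab)// ler_wpM2r ?powR_ge0//.
  have [->|cn0] := eqVneq c 0; first by rewrite mul0r powR_ge0.
  apply: ger1_powR => //; apply/andP; split; last by rewrite ler_pdivrMr// mul1r.
  by rewrite divr_gt0// lt_def cn0.
apply: le_trans (lerD (key a a0 _) (key b b0 _)); rewrite ?lerDl ?lerDr//.
by rewrite -mulrDl -mulrDl divff// mul1r.
Qed.

Lemma powR_sum_le (I : Type) (r : seq I) (P : pred I) (f : I -> R) s :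
  0 < s -> s <= 1 -> (forall i, P i -> 0 <= f i) ->
  (\sum_(i <- r | P i) f i) `^ s <= \sum_(i <- r | P i) f i `^ s.
Proof.
move=> s0 s1 f0.
apply: (@proj2 (0 <= \sum_(i <- r | P i) f i)).
elim/big_rec2: _ => [|i y x Pi [x0 IH]]; first by rewrite powR0 ?gt_eqF.
split; first by rewrite addr_ge0 ?f0.
by apply: le_trans (powR_subadd s0 s1 (f0 i Pi) x0) _; rewrite lerD2l.
Qed.

(** Concavity of the logarithm at the weighted mean [y] of [t] and 1: with weights [s] and [1 - s],
    the right-hand sides of [ln v <= v - 1] at [v = t / y] and [v = 1 / y] add up to zero. *)
Lemma powR_le_tangent s t : 0 <= s -> s <= 1 -> 0 <= t ->
  t `^ s <= 1 + s * (t - 1).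
Proof.
move=> s0 s1 t0.
have [->|tn0] := eqVneq t 0.
  have [->|sn0] := eqVneq s 0; first by rewrite powRr0; lra.
  by rewrite powR0//; lra.
have tp : 0 < t by rewrite lt_def tn0.
set y := 1 + _.
have yp : 0 < y.
  have -> : y = (1 - s) + s * t by rewrite /y; ring.
  have [->|sn1] := eqVneq s 1; first by rewrite subrr add0r mul1r.
  by rewrite ltr_pwDl ?mulr_ge0// subr_gt0 lt_def eq_sym sn1.
rewrite -(lnK (x := y)) ?posrE// /powR (negbTE tn0) ler_expR.
have lnle u : 0 < u -> ln u <= u - 1.
  move=> u0; have {1}-> : u = 1 + (u - 1) by ring.
  by apply: le_ln1Dx; lra.
have h1 : ln (t / y) <= t / y - 1 by apply: lnle; rewrite divr_gt0.
have h2 : ln (y^-1) <= y^-1 - 1 by apply: lnle; rewrite invr_gt0.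
rewrite ln_div ?posrE// in h1; rewrite lnV ?posrE// in h2.
have h3 : s * (t / y - 1) + (1 - s) * (y^-1 - 1) = 0.
  have -> : s * (t / y - 1) + (1 - s) * (y^-1 - 1) = y / y - 1.
    by rewrite /y; ring.
  by rewrite divff ?subrr// gt_eqF.
have := ler_wpM2l s0 h1.
have s10 : 0 <= 1 - s by rewrite subr_ge0.
have := ler_wpM2l s10 h2.
by move: h3; lra.
Qed.

(** Each [f i] is compared with the tangent of the power at the mean [M]; the linear terms average
    out. *)
Lemma powR_jensen (I : finType) (m f : I -> R) s :
  0 < s -> s <= 1 -> (forall i, 0 <= m i) -> (\sum_i m i = 1) ->
  (forall i, 0 <= f i) ->
  \sum_i m i * f i `^ s <= (\sum_i m i * f i) `^ s.
Proof.
move=> s0 s1 m0 m1 f0; set M := \sum_i m i * f i.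
have M0 : 0 <= M by apply: sumr_ge0 => i _; rewrite mulr_ge0.
have [Me|Mn0] := eqVneq M 0.
  have mf0 i : m i * f i = 0.
    by move/psumr_eq0P : Me; apply => // j _; rewrite mulr_ge0.
  rewrite big1 ?powR_ge0// => i _.
  have /eqP := mf0 i; rewrite mulf_eq0 => /orP[/eqP->|/eqP->]; first by rewrite mul0r.
  by rewrite powR0 ?gt_eqF// mulr0.
have Mp : 0 < M by rewrite lt_def Mn0.
have tang i : f i `^ s <= M `^ s * (1 + s * (f i / M - 1)).
  have {1}-> : f i = M * (f i / M) by rewrite mulrC divfK.
  rewrite powRM ?divr_ge0 ?(ltW Mp)// ler_wpM2l ?powR_ge0//.
  by apply: powR_le_tangent; rewrite ?divr_ge0 ?(ltW s0) ?(ltW Mp).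
apply: le_trans (ler_sum _ (fun i _ => ler_wpM2l (m0 i) (tang i))) _.
have -> : \sum_i m i * (M `^ s * (1 + s * (f i / M - 1))) =
   M `^ s * ((1 - s) * (\sum_i m i) + s / M * (\sum_i m i * f i)).
  rewrite !mulr_sumr -big_split/= mulr_sumr; apply: eq_bigr => i _; ring.
rewrite m1 -/M divfK// mulr1 subrK mulr1//.
Qed.

(** Jensen with uniform weights. It converts an l2 bound on all buckets into an l_p bound, at the
    price of [r^(1 - s)] for [r] buckets. *)
Lemma powR_mean (I : finType) (f : I -> R) s :
  0 < s -> s <= 1 -> (forall i, 0 <= f i) ->
  \sum_i f i `^ s <= #|I|%:R `^ (1 - s) * (\sum_i f i) `^ s.
Proof.
move=> s0 s1 f0.
have [I0|In0] := eqVneq #|I| 0%N.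
  rewrite big1 ?mulr_ge0 ?powR_ge0// => i _.
  by have := max_card (pred1 i); rewrite card1 I0.
set N : R := #|I|%:R.
have Np : 0 < N by rewrite ltr0n lt0n.
have := @powR_jensen I (fun=> N^-1) f s s0 s1 _ _ f0.
rewrite -!mulr_sumr => H.
have {H} : N^-1 * \sum_i f i `^ s <= (N^-1 * \sum_i f i) `^ s.
  apply: H => [i|]; first by rewrite invr_ge0 ltW.
  by rewrite sumr_const -[X in X *+ _]mul1r -mulrnAr -mulr_natl mul1r mulfV ?gt_eqF.
rewrite ler_pdivrMl// powRM ?invr_ge0 ?(ltW Np) ?sumr_ge0// => /le_trans; apply.
rewrite mulrA ler_wpM2r ?powR_ge0//.
rewrite powRB ?powRr1 ?(ltW Np)//; last by rewrite (gt_eqF Np) implybT.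
by rewrite -powR_inv1 ?(ltW Np)// -powRrM mulN1r powRN.
Qed.

Lemma powR_le1 a x : 0 <= a -> a <= 1 -> 0 <= x -> a `^ x <= 1.
Proof.
move=> a0 a1 x0; have -> : 1 = 1 `^ x :> R by rewrite powR1.
by rewrite ge0_ler_powR ?nnegrE.
Qed.

Lemma powR_ge1 a x : 1 <= a -> 0 <= x -> 1 <= a `^ x.
Proof.
move=> a1 x0; have -> : 1 = 1 `^ x :> R by rewrite powR1.
by rewrite ge0_ler_powR ?nnegrE//; lra.
Qed.

Lemma powR_gt1 a x : 1 < a -> 0 < x -> 1 < a `^ x.
Proof.
move=> a1 x0; have -> : 1 = 1 `^ x :> R by rewrite powR1.
by rewrite gt0_ltr_powR ?nnegrE//; lra.
Qed.

(** [pw s x] is [|x|^p] for [p = 2 s]. *)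
Definition pw s x := (x ^+ 2) `^ s.

Lemma pw_ge0 s x : 0 <= pw s x. Proof. exact: powR_ge0. Qed.

Lemma pw0 s : 0 < s -> pw s 0 = 0.
Proof. by move=> s0; rewrite /pw expr0n/= powR0 ?gt_eqF. Qed.

Lemma pwM s x y : pw s (x * y) = pw s x * pw s y.
Proof. by rewrite /pw exprMn powRM ?sqr_ge0. Qed.

Lemma pw_add s a b : 0 < s -> s <= 1 -> pw s (a + b) <= 2 * (pw s a + pw s b).
Proof.
move=> s0 s1; rewrite /pw.
have h : (a + b) ^+ 2 <= 2 * (a ^+ 2 + b ^+ 2).
  by have := sqr_ge0 (a - b); nra.
apply: le_trans (ge0_ler_powR (ltW s0) _ _ h) _; rewrite ?nnegrE ?sqr_ge0//.
  by rewrite mulr_ge0// addr_ge0 ?sqr_ge0.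
rewrite powRM// ?addr_ge0 ?sqr_ge0//.
apply: ler_pM; rewrite ?powR_ge0 //.
  by rewrite ler1_powR// ler1n.
by apply: powR_subadd => //; rewrite sqr_ge0.
Qed.

End Powers.

(** * Approximate Lewis bases *)

Section Lewis.
Variable R : realType.

(** Matrix determinant lemma: one block matrix is factored into block triangular ones in two
    ways. *)
Lemma det_1Dtr k (z : 'rV[R]_k) :
  \det (1%:M + z^T *m z) = 1 + \sum_j z 0 j ^+ 2.
Proof.
have e1 : block_mx (1%:M : 'M_1) (- z) z^T 1%:M =
    block_mx (1%:M : 'M_1) 0 z^T 1%:M *m block_mx 1%:M (- z) 0 (1%:M + z^T *m z).
  by rewrite mulmx_block !mul1mx !mul0mx !mulmx1 !addr0 !mulmxN addrCA addNr addr0.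
have e2 : block_mx (1%:M : 'M_1) (- z) z^T 1%:M =
    block_mx (1%:M : 'M_1) (- z) 0 1%:M *m block_mx (1%:M + z *m z^T) 0 z^T 1%:M.
  by rewrite mulmx_block !mul1mx !mul0mx !mulmx1 !add0r !mulNmx addrK.
have := congr1 determinant e1; rewrite e2 !det_mulmx !det_lblock !det_ublock !det1 !mul1r mulr1.
move=> <-; rewrite det_mx11 !mxE eqxx; congr (_ + _).
by apply: eq_bigr => j _; rewrite !mxE expr2.
Qed.

Definition qrow n k (U : 'M[R]_(n, k)) i := \sum_j U i j ^+ 2.

Lemma qrow_ge0 n k (U : 'M[R]_(n, k)) i : 0 <= qrow U i.
Proof. by apply: sumr_ge0 => j _; rewrite sqr_ge0. Qed.

Definition Nmass n (s : R) k (U : 'M[R]_(n, k)) := \sum_i (qrow U i) `^ s.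

Lemma Nmass_ge0 n s k (U : 'M[R]_(n, k)) : 0 <= Nmass s U.
Proof. by apply: sumr_ge0 => i _; rewrite powR_ge0. Qed.

Lemma Nmass_scale n s k (U : 'M[R]_(n, k)) (mu : R) :
  Nmass s (mu *: U) = (mu ^+ 2) `^ s * Nmass s U.
Proof.
rewrite /Nmass mulr_sumr; apply: eq_bigr => i _; rewrite -powRM ?sqr_ge0 ?qrow_ge0//.
by congr (_ `^ _); rewrite /qrow mulr_sumr; apply: eq_bigr => j _; rewrite mxE exprMn.
Qed.

(** With [t] the inner product of the row and [z], the new row is the old one plus [t z]; the cross
    term gives [2 t^2] and the square [t^2]. *)
Lemma qrow_stretch n k (U : 'M[R]_(n, k)) (z : 'rV[R]_k) i :
  \sum_j z 0 j ^+ 2 = 1 ->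
  qrow (U *m (1%:M + z^T *m z)) i = qrow U i + 3 * ((U *m z^T) i 0) ^+ 2.
Proof.
move=> z1; set t := (U *m z^T) i 0.
have e j : (U *m (1%:M + z^T *m z)) i j = U i j + t * z 0 j.
  by rewrite mulmxDr mulmx1 mulmxA [LHS]mxE; congr (_ + _); rewrite mxE big_ord1.
have et : t = \sum_j U i j * z 0 j by rewrite /t mxE; apply: eq_bigr => j _; rewrite mxE.
rewrite /qrow (eq_bigr (fun j => U i j ^+ 2 + (2 * t * (U i j * z 0 j) + t ^+ 2 * z 0 j ^+ 2))); last first.
  by move=> j _; rewrite e; ring.
by rewrite !big_split/= -!mulr_sumr -et z1; ring.
Qed.

(** Uses [p >= 1]: shrinking a matrix by [mu] shrinks its mass at least by the factor [mu]. *)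
Lemma mu_sq_le (s mu : R) : 2^-1 <= s -> 0 < mu -> mu <= 1 -> (mu ^+ 2) `^ s <= mu.
Proof.
move=> s2 mu0 mu1; rewrite -powR_mulrn ?(ltW mu0)// -powRrM.
rewrite -[leRHS]powRr1 ?(ltW mu0)//; apply: ger_powR; first by rewrite mu0.
by lra.
Qed.

Lemma bernoulli_sub (x : R) k : 0 <= x -> x <= 1 -> 1 - k%:R * x <= (1 - x) ^+ k.
Proof.
move=> x0 x1; elim: k => [|k IH]; first by rewrite mul0r subr0 expr0.
rewrite exprS -natr1; apply: le_trans (ler_wpM2l _ IH); last by lra.
by have : 0 <= k%:R * x ^+ 2 by [rewrite mulr_ge0// sqr_ge0]; nra.
Qed.

(** Take [Rm] with [|det Rm|] nearly maximal among the feasible matrices. If some unit vector [z] had [sum_i |(B Rm z)_i|^p < 1/12], stretching by [1 + z^T z] would double the determinant while [sum_i ||row_i||^p] grows by at most [3/12], so that a feasible rescaling would beat the supremum. *)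
Lemma exists_lewis_full n k (s : R) (B : 'M[R]_(n, k)) (L : 'M[R]_(k, n)) :
  2^-1 <= s -> s <= 1 -> L *m B = 1%:M ->
  exists Rm : 'M[R]_k, [/\ Rm \in unitmx, Nmass s (B *m Rm) <= k%:R &
    forall z : 'rV[R]_k, \sum_j z 0 j ^+ 2 = 1 ->
      1 <= 12 * \sum_i pw s ((B *m Rm *m z^T) i 0)].
Proof.
move=> s2 s1 LB; have s0 : 0 < s by lra.
pose feas := [set Rm : 'M[R]_k | Nmass s (B *m Rm) <= k%:R]%classic.
pose S : set R := [set `|\det Rm| | Rm in feas]%classic.
(* The left inverse [L] recovers [Rm] from [B Rm], whose entries are bounded by feasibility, so
   determinants of feasible matrices are bounded. The [+ 1] avoids a square root: [v^2 <= a] implies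
   [|v| <= a + 1]. *)
have bound1 Rm : feas Rm -> forall a b, `|Rm a b| <= (\sum_i \sum_j `|L i j|) * (k%:R `^ (s^-1) + 1).
  move=> fR a b; rewrite -[Rm]mul1mx -LB -mulmxA mxE.
  apply: le_trans (ler_norm_sum _ _ _) _; rewrite mulr_suml.
  rewrite (bigD1 a)//= ler_wpDr//.
    by apply: sumr_ge0 => i _; rewrite mulr_ge0 ?sumr_ge0// addr_ge0 ?powR_ge0.
  rewrite mulr_suml; apply: ler_sum => i _; rewrite normrM ler_wpM2l//.
  have h1 : (B *m Rm) i b ^+ 2 <= k%:R `^ s^-1.
    have : (qrow (B *m Rm) i) `^ s <= k%:R.
      by apply: le_trans fR; rewrite /Nmass (bigD1 i)//= lerDl sumr_ge0// => *; rewrite powR_ge0.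
    move=> /(ge0_ler_powR (_ : 0 <= s^-1)); rewrite invr_ge0 (ltW s0) => /(_ isT).
    rewrite !nnegrE powR_ge0 ler0n => /(_ isT isT).
    rewrite -powRrM divff ?gt_eqF// powRr1 ?qrow_ge0// => /(le_trans _); apply.
    by rewrite /qrow (bigD1 b)//= lerDl sumr_ge0// => *; rewrite sqr_ge0.
  rewrite -(@ler_pXn2r _ 2) ?nnegrE//; last by rewrite addr_ge0 ?powR_ge0.
  rewrite -normrX ger0_norm ?sqr_ge0//; apply: le_trans h1 _.
  by have := powR_ge0 (k%:R : R) s^-1; nra.
have posS : exists2 Rm, feas Rm & 0 < `|\det Rm|.
    pose N := Nmass s B; pose mu := (1 + N)^-1.
    have N0 : 0 <= N := Nmass_ge0 s B.
    have m0 : 0 < mu by rewrite invr_gt0; lra.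
    exists (mu%:M); last by rewrite det_scalar normr_gt0 expf_neq0// gt_eqF.
    rewrite /feas/= mul_mx_scalar Nmass_scale -/N.
    have m1 : mu <= 1 by rewrite invf_le1; lra.
    have [k0|kn0] := eqVneq k 0%N.
      suff -> : N = 0 by rewrite mulr0.
      rewrite /N /Nmass big1// => i _; rewrite /qrow big1 ?powR0 ?gt_eqF// => j _.
      by have : (j < 0)%N by rewrite -[X in (_ < X)%N]k0.
    apply: (@le_trans _ _ 1); last by rewrite ler1n lt0n.
    apply: le_trans (ler_wpM2r N0 (mu_sq_le s2 m0 m1)) _.
    by rewrite mulrC ler_pdivrMr; lra.
have Sub : has_sup S.
  split.
    by case: posS => Rm f0 _; exists (`|\det Rm|); exists Rm.
  set M := (\sum_i \sum_j `|L i j|) * (k%:R `^ (s^-1) + 1) in bound1.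
  exists (\sum_(t : 'S_k) M ^+ k) => _ [Rm fR <-].
  apply: le_trans (ler_norm_sum _ _ _) _; apply: ler_sum => t _.
  rewrite normrM normrX normrN1 expr1n mul1r normr_prod.
  rewrite -[in leRHS](card_ord k) -prodr_const; apply: ler_prod => i _.
  by rewrite normr_ge0 bound1.
have sup0 : 0 < sup S.
  by case: posS => Rm f0 h; apply: lt_le_trans h _; apply: ub_le_sup; [case: Sub|exists Rm].
have s4 : 0 < sup S / 4 by rewrite divr_gt0.
have [_ [Rm fR <-] hR] := sup_adherent s4 Sub.
  have hdet : sup S * (3 / 4) < `|\det Rm| by move: hR; lra.
  exists Rm; split=> //.
    by rewrite unitmxE unitfE -normr_gt0; apply: lt_trans hdet; lra.
  move=> z z1; rewrite leNgt; apply/negP => hz.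
  set e := \sum_i pw s _ in hz.
  have e0 : 0 <= e by apply: sumr_ge0 => i _; apply: pw_ge0.
  have k0 : (0 < k)%N.
    rewrite lt0n; apply/eqP => k0.
    have : \sum_j z 0 j ^+ 2 = 0 by rewrite big1// => j _; have : (j < 0)%N by rewrite -[X in (_ < X)%N]k0.
    by rewrite z1 => /eqP; rewrite oner_eq0.
  have kp : (0 : R) < k%:R by rewrite ltr0n.
  (* [mu = k / (k + 3 e)] brings the mass back to [k]. By Bernoulli the determinant keeps the factor
     [1 - 3 e >= 3/4], and [3/4 * 3/4 * 2 > 1] contradicts the supremum. *)
  pose x := 3 * e / (k%:R + 3 * e); pose mu : R := 1 - x.
  have den : 0 < k%:R + 3 * e by lra.
  have mu_e : mu = k%:R / (k%:R + 3 * e).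
    have dn : k%:R + 3 * e != 0 by rewrite gt_eqF.
    by rewrite /mu /x; field.
  have x0 : 0 <= x by rewrite divr_ge0; lra.
  have x1 : x <= 1 by rewrite ler_pdivrMr//; lra.
  have m0 : 0 < mu by rewrite mu_e divr_gt0.
  pose R' := mu *: (Rm *m (1%:M + z^T *m z)).
  have fR' : feas R'.
    rewrite /feas/= /R' -scalemxAr Nmass_scale mulmxA.
    have h : Nmass s (B *m Rm *m (1%:M + z^T *m z)) <= k%:R + 3 * e.
      apply: (@le_trans _ _ (Nmass s (B *m Rm) + 3 * e)); last by rewrite lerD2r.
      rewrite /Nmass /e mulr_sumr -big_split/=; apply: ler_sum => i _.
      rewrite qrow_stretch//.
      have h0 : 0 <= 3 * ((B *m Rm *m z^T) i 0) ^+ 2 by rewrite mulr_ge0 ?sqr_ge0.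
      apply: le_trans (powR_subadd s0 s1 (qrow_ge0 _ _) h0) _; rewrite lerD2l.
      rewrite powRM ?sqr_ge0// ler_wpM2r ?pw_ge0//.
      by rewrite ler1_powR// ler1n.
    apply: le_trans (ler_pM (powR_ge0 _ _) (Nmass_ge0 _ _) (mu_sq_le s2 m0 _) h) _.
      by rewrite /mu; lra.
    by rewrite mu_e divfK// gt_eqF.
  have : `|\det R'| <= sup S by apply: ub_le_sup; [case: Sub|exists R'].
  rewrite /R' detZ det_mulmx det_1Dtr z1 !normrM normrX (gtr0_norm m0) (@ger0_norm _ (1 + 1)) ?addr_ge0//.
  have kx : k%:R * x <= 3 * e.
    by rewrite /x mulrA ler_pdivrMr//; nra.
  have := bernoulli_sub k x0 x1; rewrite -/mu => mk h.
  have mk2 : 3 / 4 <= mu ^+ k by lra.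
  have h3 : 3 / 4 * (sup S * (3 / 4) * 2) <= mu ^+ k * (`|\det Rm| * (1 + 1)).
    by apply: ler_pM => //; lra.
  have := le_trans h3 h.
  by move: sup0; lra.
Qed.


(** The column base of [A] has full column rank, hence a left inverse, and homogeneity extends the
    bound from unit vectors. The lemma is applied twice: for [p], and at [s = 1] for a nearly
    orthonormal basis. *)
Lemma exists_lewis_basis n d (s : R) (A : 'I_n -> 'I_d -> R) :
  2^-1 <= s -> s <= 1 ->
  exists k (u : 'I_n -> 'I_k -> R), [/\ (k <= d)%N,
    \sum_i (\sum_j u i j ^+ 2) `^ s <= k%:R,
    forall x : 'I_d -> R, exists z : 'I_k -> R, forall i,
      \sum_l A i l * x l = \sum_j u i j * z j &
    forall z : 'I_k -> R,
      (\sum_j z j ^+ 2) `^ s <= 12 * \sum_i pw s (\sum_j u i j * z j)].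
Proof.
move=> s2 s1; have s0 : 0 < s by lra.
pose Am := \matrix_(i, l) A i l.
pose k := \rank Am; pose B := col_base Am.
have /row_fullP[L' LB] : row_full B by apply: col_base_full.
have [Rm [Ru RN Rz]] := exists_lewis_full s2 s1 LB.
exists k, (fun i j => (B *m Rm) i j); split.
- exact: rank_leq_col.
- exact: RN.
- move=> x; pose z := invmx Rm *m (row_base Am *m \col_l x l).
  exists (fun j => z j 0) => i.
  have : Am *m (\col_l x l) = B *m Rm *m z.
    by rewrite /z -[RHS]mulmxA (mulmxA Rm) mulmxV// mul1mx mulmxA mulmx_base.
  move=> /matrixP/(_ i 0); rewrite !mxE => <-.
  by apply: eq_bigr => l _; rewrite !mxE.
- move=> z; set t := \sum_j z j ^+ 2.
  have t0 : 0 <= t by apply: sumr_ge0 => j _; rewrite sqr_ge0.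
  have [te|tn0] := eqVneq t 0.
    by rewrite te powR0 ?gt_eqF// mulr_ge0// sumr_ge0// => i _; apply: pw_ge0.
  have tp : 0 < t by rewrite lt_def tn0.
  pose v := \row_j (z j / Num.sqrt t).
  have st : 0 < Num.sqrt t by rewrite sqrtr_gt0.
  have v1 : \sum_j v 0 j ^+ 2 = 1.
    under eq_bigr => j _ do rewrite mxE exprMn exprVn sqr_sqrtr//.
    by rewrite -mulr_suml divff.
  have := Rz v v1.
  have e i : pw s ((B *m Rm *m v^T) i 0) = (t `^ s)^-1 * pw s (\sum_j (B *m Rm) i j * z j).
    have -> : (B *m Rm *m v^T) i 0 = (Num.sqrt t)^-1 * \sum_j (B *m Rm) i j * z j.
      by rewrite mxE mulr_sumr; apply: eq_bigr => j _; rewrite !mxE; ring.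
    rewrite pwM; congr (_ * _).
    by rewrite /pw exprVn sqr_sqrtr// -powR_inv1// -powRrM mulN1r powRN.
  rewrite (eq_bigr _ (fun i _ => e i)) -mulr_sumr mulrCA ler_pdivlMl ?powR_gt0//.
  by rewrite mulr1.
Qed.

End Lewis.

(** * Finite probability distributions *)

Section FinProb.
Variable R : realType.

Record fdist (T : finType) := FDist {
  fdw :> T -> R;
  fdw_ge0 : forall t, 0 <= fdw t;
  fdw_sum : \sum_t fdw t = 1 }.

Section Expectation.
Variables (T : finType) (m : fdist T).
Implicit Types (f g : T -> R) (A B : T -> Prop).

Definition Ex f := \sum_t m t * f t.
Definition Pr A := Ex (fun t => `[< A t >]%:R).

Lemma Ex_ge0 f : (forall t, 0 <= f t) -> 0 <= Ex f.
Proof. by move=> f0; apply: sumr_ge0 => t _; rewrite mulr_ge0 ?fdw_ge0. Qed.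

Lemma Ex_le f g : (forall t, f t <= g t) -> Ex f <= Ex g.
Proof. by move=> fg; apply: ler_sum => t _; rewrite ler_wpM2l ?fdw_ge0. Qed.

Lemma eq_Ex f g : f =1 g -> Ex f = Ex g.
Proof. by move=> fg; apply: eq_bigr => t _; rewrite fg. Qed.

Lemma Ex_cst c : Ex (fun=> c) = c.
Proof. by rewrite /Ex -mulr_suml fdw_sum mul1r. Qed.

Lemma ExD f g : Ex (fun t => f t + g t) = Ex f + Ex g.
Proof. by rewrite /Ex -big_split; apply: eq_bigr => t _; rewrite mulrDr. Qed.

Lemma ExZ c f : Ex (fun t => c * f t) = c * Ex f.
Proof. by rewrite /Ex mulr_sumr; apply: eq_bigr => t _; rewrite mulrCA. Qed.

Lemma ExZr c f : Ex (fun t => f t * c) = Ex f * c.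
Proof. by rewrite mulrC -ExZ; apply: eq_Ex => t; rewrite mulrC. Qed.

Lemma Ex_sum (I : Type) (r : seq I) (P : pred I) (F : I -> T -> R) :
  Ex (fun t => \sum_(i <- r | P i) F i t) = \sum_(i <- r | P i) Ex (F i).
Proof.
by rewrite /Ex exchange_big; apply: eq_bigr => t _; rewrite mulr_sumr.
Qed.

Lemma Ex_jensen f s : 0 < s -> s <= 1 -> (forall t, 0 <= f t) ->
  Ex (fun t => f t `^ s) <= (Ex f) `^ s.
Proof. by move=> s0 s1 f0; apply: powR_jensen => // [t|]; [exact: fdw_ge0|exact: fdw_sum]. Qed.

Lemma Pr_ge0 A : 0 <= Pr A.
Proof. exact: Ex_ge0. Qed.

Lemma Pr_le A B : (forall t, A t -> B t) -> Pr A <= Pr B.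
Proof.
move=> AB; apply: Ex_le => t; rewrite ler_nat.
by case: asboolP => // /AB Bt; rewrite asboolT.
Qed.

Lemma Pr_true : Pr (fun=> True) = 1.
Proof. by rewrite -[RHS]Ex_cst; apply: eq_Ex => t; rewrite asboolT. Qed.

Lemma Pr_or A B : Pr (fun t => A t \/ B t) <= Pr A + Pr B.
Proof.
rewrite -ExD; apply: Ex_le => t; rewrite -natrD ler_nat asbool_or.
by case: `[< A t >]; case: `[< B t >].
Qed.

Lemma Pr_not A : Pr (fun t => ~ A t) = 1 - Pr A.
Proof.
rewrite -(Ex_cst 1) -(mulN1r (Pr A)) -ExZ -ExD; apply: eq_Ex => t.
by rewrite asbool_neg; case: `[< A t >]; rewrite /=; ring.
Qed.

Lemma Pr_exists (I : finType) (A : I -> T -> Prop) :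
  Pr (fun t => exists i, A i t) <= \sum_i Pr (A i).
Proof.
rewrite -Ex_sum; apply: Ex_le => t; case: asboolP => [[i Ai]|_]; last exact: sumr_ge0.
by rewrite (bigD1 i)//= asboolT// lerDl sumr_ge0.
Qed.

Lemma markov_le A f c delta : 0 < c -> (forall t, 0 <= f t) ->
  (forall t, A t -> c <= f t) -> Ex f <= delta * c -> Pr A <= delta.
Proof.
move=> c0 f0 Af h; rewrite -(ler_pM2r c0); apply: le_trans h; rewrite -ExZr.
apply: Ex_le => t; case: asboolP => [/Af|_]; first by rewrite mul1r.
by rewrite mul0r.
Qed.

Lemma markov f c delta : 0 < c -> (forall t, 0 <= f t) -> Ex f <= delta * c ->
  Pr (fun t => c < f t) <= delta.
Proof. by move=> c0 f0; apply: markov_le => // t /ltW. Qed.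

End Expectation.

Section Product.
Variables (T1 T2 : finType) (m1 : fdist T1) (m2 : fdist T2).

Fact fprod_ge0 (t : T1 * T2) : 0 <= m1 t.1 * m2 t.2.
Proof. by rewrite mulr_ge0 ?fdw_ge0. Qed.

Fact fprod_sum : \sum_(t : T1 * T2) m1 t.1 * m2 t.2 = 1.
Proof.
rewrite -(pair_big xpredT xpredT (fun i j => m1 i * m2 j))/=.
by under eq_bigr do rewrite -mulr_sumr fdw_sum mulr1; rewrite fdw_sum.
Qed.

Definition fprod := FDist fprod_ge0 fprod_sum.

Lemma Ex_fprod (f : T1 -> T2 -> R) :
  Ex fprod (fun t => f t.1 t.2) = Ex m1 (fun t1 => Ex m2 (f t1)).
Proof.
rewrite /Ex/= -(pair_big xpredT xpredT (fun i j => m1 i * m2 j * f i j))/=.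
by apply: eq_bigr => i _; rewrite mulr_sumr; apply: eq_bigr => j _; rewrite mulrA.
Qed.

Lemma Ex_exchange (f : T1 -> T2 -> R) :
  Ex m1 (fun t1 => Ex m2 (f t1)) = Ex m2 (fun t2 => Ex m1 (f ^~ t2)).
Proof.
rewrite /Ex; under eq_bigr do rewrite mulr_sumr.
rewrite exchange_big/=; apply: eq_bigr => j _; rewrite mulr_sumr.
by apply: eq_bigr => i _; rewrite mulrCA.
Qed.

Lemma Pr_fprodl (A : T1 -> Prop) : Pr fprod (fun t => A t.1) = Pr m1 A.
Proof.
rewrite /Pr (Ex_fprod (fun t1 _ => `[< A t1 >]%:R)).
by apply: eq_Ex => t; rewrite Ex_cst.
Qed.

Lemma Pr_fprodr (A : T2 -> Prop) : Pr fprod (fun t => A t.2) = Pr m2 A.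
Proof. by rewrite /Pr (Ex_fprod (fun _ t2 => `[< A t2 >]%:R)) Ex_cst. Qed.

End Product.

Section Power.
Variables (I T : finType) (m : fdist T).

Fact fpow_ge0 (f : {ffun I -> T}) : 0 <= \prod_i m (f i).
Proof. by apply: prodr_ge0 => i _; apply: fdw_ge0. Qed.

Fact fpow_sum : \sum_(f : {ffun I -> T}) \prod_i m (f i) = 1.
Proof.
rewrite -(bigA_distr_bigA (fun (_ : I) t => m t)) big1// => i _; exact: fdw_sum.
Qed.

Definition fpow := FDist fpow_ge0 fpow_sum.

Lemma Ex_fpow_prod (g : I -> T -> R) :
  Ex fpow (fun f => \prod_i g i (f i)) = \prod_i Ex m (g i).
Proof.
rewrite /Ex/= (bigA_distr_bigA (fun i t => m t * g i t)).
by apply: eq_bigr => f _; rewrite -big_split.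
Qed.

Lemma Ex_fpow1 (i : I) (g : T -> R) : Ex fpow (fun f => g (f i)) = Ex m g.
Proof.
have := Ex_fpow_prod (fun j t => if j == i then g t else 1).
rewrite (bigD1 i)//= eqxx big1 ?mulr1; last by move=> j /negbTE->; rewrite Ex_cst.
move=> <-; apply: eq_Ex => f; rewrite (bigD1 i)//= eqxx big1 ?mulr1//.
by move=> j /negbTE->.
Qed.

Lemma Ex_fpow2 (i j : I) (g h : T -> R) : i != j ->
  Ex fpow (fun f => g (f i) * h (f j)) = Ex m g * Ex m h.
Proof.
move=> ij; have ji : j != i by rewrite eq_sym.
have := Ex_fpow_prod (fun l t => if l == i then g t else if l == j then h t else 1).
rewrite (bigD1 i)//= eqxx (bigD1 j) //= (negbTE ji) eqxx big1 ?mulr1; last first.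
  by move=> l /andP[/negbTE-> /negbTE->]; rewrite Ex_cst.
move=> <-; apply: eq_Ex => f; rewrite (bigD1 i)//= eqxx (bigD1 j)//= (negbTE ji) eqxx.
by rewrite big1 ?mulr1// => l /andP[/negbTE-> /negbTE->].
Qed.

End Power.

Section Uniform.
Variables (T : finType) (T0 : (0 < #|T|)%N).

Fact funif_ge0 (t : T) : 0 <= #|T|%:R^-1 :> R.
Proof. by rewrite invr_ge0. Qed.

Fact funif_sum : \sum_(t : T) #|T|%:R^-1 = 1 :> R.
Proof. by rewrite sumr_const -[LHS]mulr_natl divff// pnatr_eq0 -lt0n. Qed.

Definition funif := FDist funif_ge0 funif_sum.

Lemma Ex_funif (f : T -> R) : Ex funif f = #|T|%:R^-1 * \sum_t f t.
Proof. by rewrite mulr_sumr. Qed.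

End Uniform.

Section OrthonormalSystem.
Variables (T : finType) (m : fdist T) (K : finType) (phi : K -> T -> R).
Hypothesis ortho : forall a b, Ex m (fun t => phi a t * phi b t) = (a == b)%:R.

(** Serves both the signs and their products over pairs [i < j], two orthonormal systems. *)
Lemma Ex_parseval (c : K -> R) :
  Ex m (fun t => (\sum_a phi a t * c a) ^+ 2) = \sum_a c a ^+ 2.
Proof.
have e t : (\sum_a phi a t * c a) ^+ 2 =
    \sum_a \sum_b c a * c b * (phi a t * phi b t).
  rewrite expr2 mulr_suml; apply: eq_bigr => a _; rewrite mulr_sumr.
  by apply: eq_bigr => b _; ring.
rewrite (eq_Ex _ e) Ex_sum; apply: eq_bigr => a _; rewrite Ex_sum.
under eq_bigr do rewrite ExZ ortho.
rewrite (bigD1 a)//= eqxx big1 ?addr0 ?mulr1 ?expr2//.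
by move=> b /negbTE; rewrite eq_sym => ->; rewrite mulr0.
Qed.

End OrthonormalSystem.

Section Signs.
Variable n : nat.
Lemma card_bool_gt0 : (0 < #|{: bool}|)%N. Proof. by rewrite card_bool. Qed.

Definition signs := fpow 'I_n (funif card_bool_gt0).
Definition sg (e : {ffun 'I_n -> bool}) (i : 'I_n) : R := (-1) ^+ e i.

Lemma sg_sq e i : sg e i ^+ 2 = 1.
Proof. by rewrite /sg sqrr_sign. Qed.

(** A monomial in independent signs averages to zero unless every exponent is even, so both
    orthogonality relations below reduce to parities. *)
Lemma Ex_sg_prod (h : 'I_n -> nat) :
  Ex signs (fun e => \prod_i sg e i ^+ h i) = [forall i, ~~ odd (h i)]%:R.
Proof.
rewrite (Ex_fpow_prod _ (fun i (b : bool) => ((-1) ^+ b) ^+ h i)).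
have E i : Ex (funif card_bool_gt0) (fun b : bool => ((-1) ^+ b : R) ^+ h i) = (~~ odd (h i))%:R.
  rewrite Ex_funif big_bool card_bool/= expr0 expr1 expr1n -signr_odd.
  by case: odd; rewrite ?expr0 ?expr1/=; lra.
under eq_bigr do rewrite E.
case: forallP => [h0|].
  by rewrite big1// => i _; rewrite h0.
move=> /forallP; rewrite negb_forall => /existsP[i hi].
by rewrite (bigD1 i)//= (negbTE hi) mul0r.
Qed.

Lemma sg_prodE e (i : 'I_n) : sg e i = \prod_l sg e l ^+ (l == i).
Proof.
rewrite (bigD1 i)//= eqxx expr1 big1 ?mulr1// => l /negbTE->; exact: expr0.
Qed.

Lemma sg_ortho1 i j : Ex signs (fun e => sg e i * sg e j) = (i == j)%:R.
Proof.
have -> : Ex signs (fun e => sg e i * sg e j) =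
    Ex signs (fun e => \prod_l sg e l ^+ ((l == i) + (l == j))).
  apply: eq_Ex => e; rewrite (sg_prodE e i) (sg_prodE e j) -big_split/=.
  by apply: eq_bigr => l _; rewrite exprD.
rewrite Ex_sg_prod; congr ((nat_of_bool _)%:R); apply/forallP/eqP => [|-> l].
  by move=> /(_ i); rewrite eqxx; case: eqP.
by case: eqP.
Qed.

Lemma sg_ortho2 (i j k l : 'I_n) : (i < j)%N -> (k < l)%N ->
  Ex signs (fun e => sg e i * sg e j * (sg e k * sg e l)) =
    ((i, j) == (k, l))%:R.
Proof.
move=> ij kl.
have -> : Ex signs (fun e => sg e i * sg e j * (sg e k * sg e l)) =
    Ex signs (fun e => \prod_t sg e t ^+ ((t == i) + (t == j) + ((t == k) + (t == l)))).
  apply: eq_Ex => e; rewrite (sg_prodE e i) (sg_prodE e j) (sg_prodE e k) (sg_prodE e l) -!big_split/=.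
  by apply: eq_bigr => t _; rewrite !exprD.
rewrite Ex_sg_prod; congr ((nat_of_bool _)%:R); apply/forallP/eqP => [H|[-> ->] t]; last first.
  by case: (t == k); case: (t == l).
have nij : i == j = false by apply/eqP => e; move: ij; rewrite e ltnn.
have nkl : k == l = false by apply/eqP => e; move: kl; rewrite e ltnn.
have := H i; have := H j; rewrite !eqxx nij (eq_sym j i) nij.
have := H k; have := H l; rewrite !eqxx nkl (eq_sym l k) nkl.
case: (eqVneq i k) => [<-|ik]; case: (eqVneq j l) => [<-|jl] //=.
- by rewrite (eq_sym l i); case: (eqVneq i l) => [il|] //=; rewrite ?eqxx ?nij.
- by rewrite (eq_sym k j); case: (eqVneq j k) => [jk|] //=; rewrite ?eqxx ?nij.
case: (eqVneq i l) => [il|] //=; case: (eqVneq j k) => [jk|] //=.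
by subst; move: ij kl => /ltn_trans h /h; rewrite ltnn.
Qed.

Lemma Ex_sign_sum (c : 'I_n -> R) :
  Ex signs (fun e => (\sum_i sg e i * c i) ^+ 2) = \sum_i c i ^+ 2.
Proof. apply: (Ex_parseval (phi := fun i e => sg e i)); exact: sg_ortho1. Qed.

Lemma Ex_sign_chaos (c : 'I_n -> 'I_n -> R) :
  Ex signs (fun e => (\sum_(i < n) \sum_(j < n | (i < j)%N) sg e i * sg e j * c i j) ^+ 2) =
  \sum_(i < n) \sum_(j < n | (i < j)%N) c i j ^+ 2.
Proof.
pose K := {t : 'I_n * 'I_n | (t.1 < t.2)%N}.
have ort (a b : K) : Ex signs (fun e => sg e (val a).1 * sg e (val a).2 * (sg e (val b).1 * sg e (val b).2)) = (a == b)%:R.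
  by rewrite sg_ortho2 ?(valP a) ?(valP b)// -!surjective_pairing.
have S (F : 'I_n -> 'I_n -> R) :
    \sum_(i < n) \sum_(j < n | (i < j)%N) F i j = \sum_(a : K) F (val a).1 (val a).2.
  rewrite pair_big_dep/= (reindex_omap (val : K -> _) insub)/=; last first.
    by move=> t ht; rewrite insubT.
  by apply: eq_bigl => a; rewrite valK eqxx (valP a).
rewrite S -(Ex_parseval ort); apply: eq_Ex => e; by rewrite S.
Qed.

End Signs.
End FinProb.

(** * CountSketch *)

Section Sums.
Variable R : realType.

Lemma cauchy_schwarz (I : finType) (P : pred I) (a b : I -> R) :
  (\sum_(i | P i) a i * b i) ^+ 2 <=
  (\sum_(i | P i) a i ^+ 2) * (\sum_(i | P i) b i ^+ 2).
Proof.
have h : 0 <= \sum_(i | P i) \sum_(j | P j) (a i * b j - a j * b i) ^+ 2.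
  by apply: sumr_ge0 => i _; apply: sumr_ge0 => j _; rewrite sqr_ge0.
set X := \sum_(i | P i) a i ^+ 2; set Y := \sum_(i | P i) b i ^+ 2.
set Z := \sum_(i | P i) a i * b i.
have e : \sum_(i | P i) \sum_(j | P j) (a i * b j - a j * b i) ^+ 2 =
    X * Y + Y * X - (Z * Z) *+ 2.
  rewrite /X /Y /Z !mulr_suml -sumrMnl -sumrN -!big_split/=.
  apply: eq_bigr => i _; rewrite !mulr_sumr -sumrMnl -sumrN -!big_split/=.
  by apply: eq_bigr => j _; ring.
by move: h; rewrite e expr2; lra.
Qed.

Lemma sum_offdiag n (F : 'I_n -> 'I_n -> R) :
  \sum_i \sum_j F i j =
  \sum_i F i i + \sum_(i < n) \sum_(j < n | (i < j)%N) (F i j + F j i).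
Proof.
have e i : \sum_j F i j = F i i + (\sum_(j < n | (i < j)%N) F i j + \sum_(j < n | (j < i)%N) F i j).
  rewrite (bigD1 i)//=; congr (_ + _).
  rewrite (bigID (fun j : 'I_n => (i < j)%N))/=; congr (_ + _); apply: eq_bigl => j.
    by rewrite -val_eqE neq_ltn; case: ltngtP.
  by rewrite -val_eqE neq_ltn; case: ltngtP.
under eq_bigr do rewrite e.
rewrite big_split/=; congr (_ + _); rewrite big_split/=.
under [RHS]eq_bigr do rewrite big_split/=.
rewrite [RHS]big_split/=; congr (_ + _).
by rewrite (exchange_big_dep xpredT).
Qed.

End Sums.

Section CountSketch.
Variables (R : realType) (n r : nat).
Hypothesis r_gt0 : (0 < #|'I_r|)%N.
Implicit Types (h : {ffun 'I_n -> 'I_r}) (e : {ffun 'I_n -> bool}) (y : 'I_n -> R).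

Definition bucket e h y b : R := \sum_(i | h i == b) sg R e i * y i.

Lemma sum_bucket (F : 'I_n -> R) h : \sum_b \sum_(i | h i == b) F i = \sum_i F i.
Proof. by rewrite [RHS](partition_big h xpredT). Qed.

Lemma sum_sq_by_bucket (t : 'I_n -> R) h :
  \sum_b (\sum_(i | h i == b) t i) ^+ 2 = \sum_i \sum_j (h i == h j)%:R * (t i * t j).
Proof.
rewrite -(sum_bucket _ h); apply: eq_bigr => b _.
rewrite expr2 mulr_suml; apply: eq_bigr => i /eqP hi.
rewrite mulr_sumr [RHS](bigID (fun j => h j == b))/= [X in _ + X]big1 ?addr0; last first.
  by move=> j /negbTE hj; rewrite hi eq_sym hj mul0r.
by apply: eq_bigr => j /eqP hj; rewrite hi hj eqxx mul1r.
Qed.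

Definition hashes := fpow 'I_n (funif R r_gt0).

Lemma Ex_collision (i j : 'I_n) : i != j ->
  Ex hashes (fun h => (h i == h j)%:R) = r%:R^-1.
Proof.
move=> ij.
have r0 : r%:R != 0 :> R by rewrite pnatr_eq0 -lt0n -(card_ord r).
have e (h : {ffun 'I_n -> 'I_r}) : (h i == h j)%:R = \sum_(b : 'I_r) (h i == b)%:R * (h j == b)%:R :> R.
  rewrite (bigD1 (h i))//= eqxx mul1r big1 ?addr0 1?eq_sym// => b /negbTE.
  by rewrite eq_sym => ->; rewrite mul0r.
rewrite (eq_Ex _ e) Ex_sum.
have pt b : Ex (funif R r_gt0) (fun c => (c == b)%:R) = r%:R^-1.
  rewrite Ex_funif (bigD1 b)//= eqxx big1 ?addr0 ?mulr1 ?card_ord//.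
  by move=> c /negbTE->.
under eq_bigr do rewrite (Ex_fpow2 _ (fun c => (c == _)%:R) (fun c => (c == _)%:R) ij) !pt.
by rewrite sumr_const card_ord -[LHS]mulr_natl mulrA divff// mul1r.
Qed.

Lemma Ex_load (c : 'I_n -> R) : (forall i, 0 <= c i) ->
  Ex hashes (fun h => \sum_b (\sum_(i | h i == b) c i) ^+ 2) <=
  \sum_i c i ^+ 2 + (\sum_i c i) ^+ 2 / r%:R.
Proof.
move=> c0; rewrite (eq_Ex _ (sum_sq_by_bucket c)) Ex_sum.
under eq_bigr do rewrite Ex_sum.
rewrite expr2 !mulr_suml -big_split/=; apply: ler_sum => i _.
rewrite mulr_sumr mulr_suml (bigD1 i)//= [in X in _ <= X](bigD1 i)//=.
apply: lerD.
  by under eq_Ex do rewrite eqxx mul1r -expr2; rewrite Ex_cst.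
rewrite -[leLHS]add0r; apply: lerD; first by rewrite divr_ge0 ?mulr_ge0.
by apply: ler_sum => j ji; rewrite ExZr Ex_collision 1?eq_sym// mulrC.
Qed.

(** In a bucket with at most [ell] entries of [H], Cauchy-Schwarz loses the factor [ell]. The
    largest load is bounded by the l2 norm of all loads, which second moments control. *)
Lemma load_pw s ell e h (H : pred 'I_n) y : 0 < s -> s <= 1 -> 0 <= ell ->
  \sum_b (\sum_(i | h i == b) (H i)%:R) ^+ 2 <= ell ^+ 2 ->
  \sum_b pw s (bucket e h (fun i => (H i)%:R * y i) b) <= ell `^ s * \sum_i pw s (y i).
Proof.
move=> s0 s1 l0 hl; rewrite -(sum_bucket _ h) mulr_sumr; apply: ler_sum => b _.
have lb : \sum_(i | h i == b) (H i)%:R <= ell.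
  rewrite -(@ler_pXn2r _ 2) ?nnegrE ?sumr_ge0//; apply: le_trans hl.
  by rewrite (bigD1 b)//= lerDl sumr_ge0// => c _; rewrite sqr_ge0.
have cs : (bucket e h (fun i => (H i)%:R * y i) b) ^+ 2 <=
    ell * \sum_(i | h i == b) y i ^+ 2.
  have -> : bucket e h (fun i => (H i)%:R * y i) b =
      \sum_(i | h i == b) (H i)%:R * (sg R e i * y i).
    by apply: eq_bigr => i _; rewrite mulrCA.
  apply: le_trans (cauchy_schwarz _ _ _) _; apply: ler_pM.
  - by rewrite sumr_ge0// => i _; rewrite sqr_ge0.
  - by rewrite sumr_ge0// => i _; rewrite sqr_ge0.
  - by apply: le_trans lb; apply: ler_sum => i _; case: (H i); rewrite ?expr0n ?expr1n.
  - by apply: ler_sum => i _; rewrite exprMn sg_sq mul1r.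
apply: le_trans (ge0_ler_powR (ltW s0) _ _ cs) _; rewrite ?nnegrE ?sqr_ge0//.
  by rewrite mulr_ge0// sumr_ge0// => i _; rewrite sqr_ge0.
rewrite powRM// ?sumr_ge0// => [|i _]; last by rewrite sqr_ge0.
by rewrite ler_wpM2l ?powR_ge0//; apply: powR_sum_le => // i _; rewrite sqr_ge0.
Qed.

(** * CountSketch as approximate matrix multiplication *)

Section MatrixMultiplication.
Variables (k : nat) (u : 'I_n -> 'I_k -> R).

Let lin (x : 'I_k -> R) i := \sum_a u i a * x a.

(** The entry [(a, b)] of [U^T (S^T S - I) U]; terms with [i = j] are absent because signs square to
    1. *)
Let cross e h a b : R := \sum_(i < n) \sum_(j < n | (i < j)%N)
  sg R e i * sg R e j * ((h i == h j)%:R * (u i a * u j b + u j a * u i b)).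

Lemma sketch_norm_diff e h x :
  \sum_b (bucket e h (lin x) b) ^+ 2 - \sum_i lin x i ^+ 2 =
  \sum_(t : 'I_k * 'I_k) cross e h t.1 t.2 * (x t.1 * x t.2).
Proof.
rewrite sum_sq_by_bucket sum_offdiag.
under eq_bigr do rewrite eqxx mul1r -expr2 exprMn sg_sq mul1r.
rewrite addrC addKr.
under [RHS]eq_bigr do rewrite mulr_suml.
rewrite exchange_big/=; apply: eq_bigr => i _.
under [RHS]eq_bigr do rewrite mulr_suml.
rewrite exchange_big/=; apply: eq_bigr => j _.
rewrite (eq_sym (h j)).
have e2 : lin x i * lin x j + lin x j * lin x i =
    \sum_(t : 'I_k * 'I_k) (u i t.1 * u j t.2 + u j t.1 * u i t.2) * (x t.1 * x t.2).
  rewrite -(pair_big xpredT xpredT (fun a b => (u i a * u j b + u j a * u i b) * (x a * x b)))/=.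
  rewrite /lin !mulr_suml -big_split/=; apply: eq_bigr => a _.
  rewrite !mulr_sumr -big_split/=; apply: eq_bigr => b _; ring.
transitivity (sg R e i * sg R e j * (h i == h j)%:R * (lin x i * lin x j + lin x j * lin x i)).
  by ring.
by rewrite e2 mulr_sumr; apply: eq_bigr => t _; ring.
Qed.

(** Products of signs over pairs [i < j] are orthonormal, so the squared Frobenius norm averages to
    a sum over colliding pairs, each of weight at most [4 q_i q_j] and colliding with probability
    [1 / r]. *)
Lemma Ex_cross (Q : R) : \sum_i \sum_j u i j ^+ 2 <= Q ->
  Ex hashes (fun h => Ex (signs R n) (fun e =>
    \sum_(t : 'I_k * 'I_k) cross e h t.1 t.2 ^+ 2)) <= 2 * Q ^+ 2 / r%:R.
Proof.
move=> hQ.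
have Q0 : 0 <= Q.
  by apply: le_trans hQ; apply: sumr_ge0 => i _; apply: sumr_ge0 => j _; rewrite sqr_ge0.
pose G i j := \sum_(t : 'I_k * 'I_k) (u i t.1 * u j t.2 + u j t.1 * u i t.2) ^+ 2.
pose q i := \sum_j u i j ^+ 2.
have Gle i j : G i j <= 4 * (q i * q j).
  have -> : 4 * (q i * q j) = \sum_(t : 'I_k * 'I_k) 2 * ((u i t.1 * u j t.2) ^+ 2 + (u j t.1 * u i t.2) ^+ 2).
    rewrite -mulr_sumr -(pair_big xpredT xpredT (fun a b => (u i a * u j b) ^+ 2 + (u j a * u i b) ^+ 2))/=.
    have -> : \sum_a \sum_b ((u i a * u j b) ^+ 2 + (u j a * u i b) ^+ 2) = q i * q j + q j * q i.
      rewrite /q !mulr_suml -big_split/=; apply: eq_bigr => a _.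
      by rewrite !mulr_sumr -big_split/=; apply: eq_bigr => b _; rewrite !exprMn.
    by ring.
  apply: ler_sum => t _.
  by have := sqr_ge0 (u i t.1 * u j t.2 - u j t.1 * u i t.2); nra.
have e h : Ex (signs R n) (fun e => \sum_(t : 'I_k * 'I_k) cross e h t.1 t.2 ^+ 2) =
    \sum_(i < n) \sum_(j < n | (i < j)%N) (h i == h j)%:R * G i j.
  rewrite Ex_sum; under eq_bigr do rewrite Ex_sign_chaos.
  rewrite exchange_big/=; apply: eq_bigr => i _.
  rewrite exchange_big/=; apply: eq_bigr => j _.
  rewrite mulr_sumr; apply: eq_bigr => t _; rewrite exprMn.
  by case: (h i == h j); rewrite ?expr1n ?expr0n.
rewrite (eq_Ex _ e) Ex_sum.
apply: (@le_trans _ _ (\sum_(i < n) \sum_(j < n | (i < j)%N) 4 * (q i * q j) / r%:R)).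
  apply: ler_sum => i _; rewrite Ex_sum; apply: ler_sum => j ij.
  rewrite ExZr Ex_collision; last by apply/eqP => eij; move: ij; rewrite eij ltnn.
  by rewrite mulrC ler_wpM2r// invr_ge0.
have q0 i : 0 <= q i by apply: sumr_ge0 => j _; rewrite sqr_ge0.
have : \sum_(i < n) \sum_(j < n | (i < j)%N) (q i * q j + q j * q i) <= Q ^+ 2.
  apply: (@le_trans _ _ ((\sum_i q i) ^+ 2)); last first.
    by rewrite ler_pXn2r// nnegrE ?sumr_ge0// => *; apply: q0.
  have -> : (\sum_i q i) ^+ 2 = \sum_i \sum_j q i * q j.
    by rewrite expr2 mulr_suml; apply: eq_bigr => i _; rewrite mulr_sumr.
  by rewrite sum_offdiag lerDr sumr_ge0// => i _; rewrite mulr_ge0.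
move=> h; have rp : (0 < r)%N by move: r_gt0; rewrite card_ord.
have r0 : r%:R != 0 :> R by rewrite pnatr_eq0 -lt0n.
rewrite ler_pdivlMr ?ltr0n// mulr_suml; under eq_bigr do rewrite mulr_suml.
under eq_bigr do under eq_bigr do rewrite divfK//.
apply: le_trans _ (ler_wpM2l (ler0n _ 2) h).
rewrite mulr_sumr; apply: ler_sum => i _; rewrite mulr_sumr; apply: ler_sum => j _.
by rewrite le_eqVlt; apply/orP; left; apply/eqP; ring.
Qed.

(** Markov bounds the Frobenius norm of the error matrix, and Cauchy-Schwarz over index pairs makes
    this one event serve all [x] at once. *)
Lemma sketch_norm_concentration (Q eps delta : R) :
  0 < eps -> \sum_i \sum_j u i j ^+ 2 <= Q ->
  2 * Q ^+ 2 / r%:R <= delta * eps ^+ 2 ->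
  Pr (fprod hashes (signs R n)) (fun w => ~ forall x,
    `|\sum_b (bucket w.2 w.1 (lin x) b) ^+ 2 - \sum_i lin x i ^+ 2|
       <= eps * \sum_a x a ^+ 2) <= delta.
Proof.
move=> e0 hQ hr.
pose f (w : {ffun 'I_n -> 'I_r} * {ffun 'I_n -> bool}) := \sum_(t : 'I_k * 'I_k) cross w.2 w.1 t.1 t.2 ^+ 2.
have f0 w : 0 <= f w by apply: sumr_ge0 => t _; rewrite sqr_ge0.
have e20 : 0 < eps ^+ 2 by rewrite exprn_gt0.
apply: le_trans (Pr_le _ _) (markov (m := fprod hashes (signs R n)) (f := f) e20 f0 _); last first.
  rewrite (Ex_fprod _ _ (fun h e => \sum_(t : 'I_k * 'I_k) cross e h t.1 t.2 ^+ 2)).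
  exact: le_trans (Ex_cross hQ) hr.
move=> w nw; rewrite ltNge; apply/negP => fw; apply: nw => x.
have x0 : 0 <= \sum_a x a ^+ 2 by apply: sumr_ge0 => a _; rewrite sqr_ge0.
rewrite -(@ler_pXn2r _ 2) ?nnegrE// ?mulr_ge0 ?(ltW e0)//.
rewrite -normrX ger0_norm ?sqr_ge0// sketch_norm_diff; apply: le_trans (cauchy_schwarz _ _ _) _.
rewrite exprMn; apply: ler_pM => //.
- by apply: sumr_ge0 => t _; rewrite sqr_ge0.
- by apply: sumr_ge0 => t _; rewrite sqr_ge0.
rewrite -(pair_big xpredT xpredT (fun a b => (x a * x b) ^+ 2))/= expr2 mulr_suml.
apply: ler_sum => a _; rewrite mulr_sumr; apply: ler_sum => b _.
by rewrite exprMn.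
Qed.

End MatrixMultiplication.
End CountSketch.

(** * Dyadic heavy-tailed dilations *)

Section HeavyTail.
Variables (R : realType) (K : nat).
Implicit Types (w a tau T : R).

(** Normalised so that [P(level >= j) = 2^-j] for [j <= K]. *)
Definition levelw (k : 'I_K.+1) : R := if k == K :> nat then 2^-1 ^+ K else 2^-1 ^+ k.+1.

Fact levelw_ge0 k : 0 <= levelw k.
Proof. by rewrite /levelw; case: ifP => _; rewrite exprn_ge0// invr_ge0. Qed.

Lemma levelw_tail (j : nat) : (j <= K)%N ->
  \sum_(k < K.+1 | (j <= k)%N) levelw k = 2^-1 ^+ j.
Proof.
move=> jK.
have -> : \sum_(k < K.+1 | (j <= k)%N) levelw k =
    \sum_(j <= k < K.+1) (if k == K then 2^-1 ^+ K else 2^-1 ^+ k.+1).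
  by rewrite (big_nat_widenl _ 0) ?big_mkord.
rewrite big_nat_recr//= eqxx.
have -> : \sum_(j <= k < K) (if k == K then 2^-1 ^+ K else 2^-1 ^+ k.+1) =
    - \sum_(j <= k < K) ((2^-1 : R) ^+ k.+1 - 2^-1 ^+ k).
  rewrite -sumrN; apply: eq_big_nat => k /andP[_ kK].
  by rewrite (ltn_eqF kK) exprS; lra.
by rewrite telescope_sumr// opprB subrK.
Qed.

Fact levelw_sum : \sum_k levelw k = 1.
Proof. by rewrite -(expr0 (2^-1)) -(levelw_tail (leq0n K)). Qed.

Definition levels := FDist levelw_ge0 levelw_sum.

Lemma levelw_le (k : 'I_K.+1) : levelw k <= 2^-1 ^+ k.
Proof.
rewrite /levelw; case: eqP => [->//|_]; rewrite exprS.
have : (0 : R) <= 2^-1 ^+ k by rewrite exprn_ge0// invr_ge0.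
by lra.
Qed.

(** The least level [j] crossing [T] has [2^-j < w / T], and the event is that the level is at least
    [j]. *)
Lemma level_tail_lt w T : 0 <= w -> 0 < T ->
  Pr levels (fun k => T < w * 2 ^+ k) <= w / T.
Proof.
move=> w0 T0; rewrite /Pr /Ex/=.
pose P := fun k : nat => (k <= K)%N && (T < w * 2 ^+ k).
have mono k l : (k <= l)%N -> w * 2 ^+ k <= w * 2 ^+ l.
  by move=> kl; rewrite ler_wpM2l// ler_weXn2l// ler1n.
case: (pselect (exists k, P k)) => [ex|nex]; last first.
  rewrite big1 ?divr_ge0 ?(ltW T0)// => k _; rewrite asboolF ?mulr0// => h.
  by apply: nex; exists k; rewrite /P -ltnS ltn_ord.
case: (ex_minnP ex) => j /andP[jK hj] jmin.
rewrite (@le_trans _ _ (2^-1 ^+ j))//.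
  rewrite -levelw_tail// [leRHS]big_mkcond/=; apply: ler_sum => k _.
  case: asboolP => [h|_]; last by rewrite mulr0; case: ifP; rewrite ?levelw_ge0.
  by rewrite jmin ?mulr1// /P -ltnS ltn_ord.
rewrite ler_pdivlMr// exprVn ler_pdivrMl ?exprn_gt0//.
by rewrite mulrC ltW.
Qed.

(** The level before the least crossing one stays below [tau], which loses the factor 2. The last
    hypothesis says that a crossing level exists below the cut-off. *)
Lemma level_tail_ge a tau : 0 < a -> a <= tau -> tau <= a * 2 ^+ K ->
  a / (2 * tau) <= Pr levels (fun k => tau <= a * 2 ^+ k).
Proof.
move=> a0 at_ tK; rewrite /Pr /Ex/=.
have t0 : 0 < tau by apply: lt_le_trans at_.
have ex : exists k, tau <= a * 2 ^+ k by exists K.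
case: (ex_minnP ex) => j hj jmin.
have jK : (j <= K)%N by apply: jmin.
rewrite (@le_trans _ _ (2^-1 ^+ j))//; last first.
  rewrite -levelw_tail// [leLHS]big_mkcond/=; apply: ler_sum => k _.
  case: ifP => [jk|_]; last by rewrite mulr_ge0 ?levelw_ge0.
  rewrite asboolT ?mulr1//; apply: le_trans hj _.
  by rewrite ler_wpM2l ?(ltW a0)// ler_weXn2l// ler1n.
rewrite ler_pdivrMr ?mulr_gt0// exprVn ler_pdivlMl ?exprn_gt0//.
case: j jmin {hj jK} => [|j] jmin.
  by rewrite expr0 mul1r; lra.
have : a * 2 ^+ j < tau.
  by rewrite ltNge; apply/negP => /jmin; rewrite ltnn.
by rewrite exprS; lra.
Qed.

Lemma geometric_below (al w : R) N : 0 < al -> 0 < w ->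
  (1 - 2 `^ (- al)) * \sum_(k < N) (w * 2 ^+ (k : nat) <= 1 :> R)%R%:R * (w * 2 ^+ (k : nat)) `^ al <= 1.
Proof.
move=> al0 w0; set g := 2 `^ (- al); pose x k := (w * 2 ^+ k) `^ al.
have g1 : g <= 1.
  by rewrite /g powRN invf_le1 ?powR_gt0// powR_ge1 ?ler1n// ltW.
have gx k : g * x k.+1 = x k.
  have -> : x k.+1 = 2 `^ al * x k.
    by rewrite /x exprS mulrCA [LHS]powRM ?mulr_ge0 ?exprn_ge0 ?(ltW w0).
  by rewrite mulrA /g powRN mulVf ?mul1r// gt_eqF// powR_gt0.
have x0 k : 0 <= x k by apply: powR_ge0.
(* Strengthened for the induction: the sum is also at most [g x_N], the term before [x_N], so that
   one more term brings it to [x_N], which is at most 1 if that term counts. *)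
apply: (@proj1 _ ((1 - g) * \sum_(k < N) (w * 2 ^+ k <= 1)%R%:R * x k <= g * x N)).
elim: N => [|N [IH1 IH2]]; first by rewrite big_ord0 mulr0 ler01 mulr_ge0// powR_ge0.
rewrite gx big_ord_recr/= mulrDr.
have g0 : 0 <= g by apply: powR_ge0.
have xN : 0 <= x N := x0 N.
case: (boolP (w * 2 ^+ N <= 1)) => h; rewrite ?mul1r ?mul0r ?mulr0 ?addr0; last first.
  by split=> //; nra.
have xN1 : x N <= 1.
  by rewrite /x powR_le1 ?(ltW al0)// mulr_ge0 ?exprn_ge0// ltW.
rewrite -/(x N).
by split; nra.
Qed.

(** Each interval [(a, 2 a]] contains at most one [w 2^k], and [t] of them cover [(1, 2^t]]. With
    [2^t] of order [d], this count is the factor [log d] of the theorem. *)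
Lemma count_dyadic w (N t : nat) : 0 < w ->
  \sum_(k < N) ((1 < w * 2 ^+ k)%R && (w * 2 ^+ k <= 2 ^+ t)%R)%:R <= t%:R :> R.
Proof.
move=> w0.
have one a : 0 < a -> \sum_(k < N) ((a < w * 2 ^+ k)%R && (w * 2 ^+ k <= 2 * a)%R)%:R <= 1 :> R.
  move=> a0; case: (pickP (fun k : 'I_N => (a < w * 2 ^+ k) && (w * 2 ^+ k <= 2 * a))) => [k /andP[k1 k2]|h]; last first.
    by rewrite big1// => k _; rewrite h.
  rewrite (bigD1 k)//= big1 ?addr0 ?k1 ?k2// => l lk.
  case: andP => // -[l1 l2]; exfalso; move: lk; rewrite -val_eqE neq_ltn => /orP[] lk.
    have : w * 2 ^+ l.+1 <= w * 2 ^+ k by rewrite ler_wpM2l ?(ltW w0)// ler_weXn2l// ler1n.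
    by rewrite exprS; lra.
  have : w * 2 ^+ k.+1 <= w * 2 ^+ l by rewrite ler_wpM2l ?(ltW w0)// ler_weXn2l// ler1n.
  by rewrite exprS; lra.
elim: t => [|t IH].
  rewrite big1// => k _; case: andP => // -[h1 h2].
  by move: (lt_le_trans h1 h2); rewrite expr0 ltxx.
have t0 : (0 : R) < 2 ^+ t by rewrite exprn_gt0.
have := lerD IH (one _ t0); rewrite natr1; apply: le_trans.
rewrite -big_split/=; apply: ler_sum => k _; rewrite -natrD ler_nat -exprS.
by case: (ltrP 1 (w * 2 ^+ k)); case: (lerP (w * 2 ^+ k) (2 ^+ t)); case: (w * 2 ^+ k <= _).
Qed.

(** Level [k] contributes at most [2^-k (w 2^k)^(1/s) = w (w 2^k)^(1/s - 1)], a geometric series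
    dominated by its last term because [p < 2]. *)
Lemma Ex_level_small w s : 0 <= w -> 0 < s -> s < 1 ->
  Ex levels (fun k => (w * 2 ^+ k <= 1)%R%:R * (w * 2 ^+ k) `^ s^-1) <=
  (1 - 2 `^ (- (s^-1 - 1)))^-1 * w.
Proof.
move=> w0 s0 s1.
have al0 : 0 < s^-1 - 1 by rewrite subr_gt0 invf_gt1.
have g1 : 0 < 1 - 2 `^ (- (s^-1 - 1)) :> R.
  by rewrite subr_gt0 powRN invf_lt1 ?powR_gt0// powR_gt1// ltr1n.
have [->|wn0] := eqVneq w 0.
  rewrite mulr0 /Ex big1// => k _; rewrite mul0r powR0 ?mulr0//.
  by rewrite invr_neq0// gt_eqF.
have wp : 0 < w by rewrite lt_def wn0.
rewrite ler_pdivlMl// -[leRHS]mulr1.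
apply: le_trans _ (ler_wpM2l w0 (geometric_below K.+1 al0 wp)).
rewrite [leRHS]mulrCA ler_wpM2l ?(ltW g1)// mulr_sumr; apply: ler_sum => k _.
have z0 : 0 <= w * 2 ^+ k by rewrite mulr_ge0 ?exprn_ge0.
rewrite -(mulr_powRB1 z0 (_ : 0 < s^-1)) ?invr_gt0//= mulrCA [leRHS]mulrCA.
rewrite ler_wpM2l//= 1?mulrA ler_wpM2r ?powR_ge0//.
apply: le_trans (ler_wpM2r z0 (levelw_le k)) _.
by rewrite mulrCA -exprMn mulVf ?pnatr_eq0// expr1n mulr1.
Qed.

(** Each counted level contributes at most [w], its probability cancelling the dilation. *)
Lemma Ex_level_large w (t : nat) : 0 <= w ->
  Ex levels (fun k => ((1 < w * 2 ^+ k)%R && (w * 2 ^+ k <= 2 ^+ t)%R)%:R * (w * 2 ^+ k)) <= t%:R * w.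
Proof.
move=> w0; have [->|wn0] := eqVneq w 0.
  by rewrite mulr0 /Ex big1// => k _; rewrite mul0r !mulr0.
have wp : 0 < w by rewrite lt_def wn0.
apply: le_trans _ (ler_wpM2r w0 (count_dyadic K.+1 t wp)).
rewrite mulr_suml; apply: ler_sum => k _; rewrite mulrCA ler_wpM2l//=.
have z0 : 0 <= w * 2 ^+ k by rewrite mulr_ge0 ?exprn_ge0.
apply: le_trans (ler_wpM2r z0 (levelw_le k)) _.
by rewrite mulrCA -exprMn mulVf ?pnatr_eq0// expr1n mulr1.
Qed.

End HeavyTail.

(** * Moments of sketched rows over random signs *)

Section SketchMoments.
Variables (R : realType) (n r k : nat) (u : 'I_n -> 'I_k -> R).
Variable h : {ffun 'I_n -> 'I_r}.

Lemma bucketE (e : {ffun 'I_n -> bool}) (y : 'I_n -> R) b :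
  bucket e h y b = \sum_i sg R e i * ((h i == b)%:R * y i).
Proof.
rewrite /bucket big_mkcond/=; apply: eq_bigr => i _.
by case: (h i == b); rewrite ?mul1r// mul0r mulr0.
Qed.

Lemma Ex_bucket_sq (c : 'I_n -> R) b :
  Ex (signs R n) (fun e => \sum_j bucket e h (fun i => c i * u i j) b ^+ 2) =
  \sum_(i | h i == b) c i ^+ 2 * \sum_j u i j ^+ 2.
Proof.
rewrite Ex_sum.
under eq_bigr do under eq_Ex do rewrite bucketE.
under eq_bigr do rewrite Ex_sign_sum.
rewrite exchange_big/= [RHS]big_mkcond/=; apply: eq_bigr => i _.
case: (h i == b); last by rewrite big1// => j _; rewrite mul0r expr0n.
by rewrite mulr_sumr; apply: eq_bigr => j _; rewrite mul1r exprMn.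
Qed.

Lemma Ex_sketch_sq (c : 'I_n -> R) :
  Ex (signs R n) (fun e => \sum_b \sum_j bucket e h (fun i => c i * u i j) b ^+ 2) =
  \sum_i c i ^+ 2 * \sum_j u i j ^+ 2.
Proof.
by rewrite Ex_sum -(sum_bucket _ h); apply: eq_bigr => b _; rewrite Ex_bucket_sq.
Qed.

(** For a fixed hash, Jensen takes the power outside the average over the signs, these kill the
    cross terms, and subadditivity splits each bucket into its rows. *)
Lemma Ex_sketch_pw (s : R) (c : 'I_n -> R) : 0 < s -> s <= 1 ->
  Ex (signs R n) (fun e => \sum_b (\sum_j bucket e h (fun i => c i * u i j) b ^+ 2) `^ s) <=
  \sum_i (c i ^+ 2 * \sum_j u i j ^+ 2) `^ s.
Proof.
move=> s0 s1; rewrite Ex_sum -(sum_bucket _ h); apply: ler_sum => b _.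
apply: le_trans (Ex_jensen _ s0 s1 _) _ => [e|].
  by apply: sumr_ge0 => j _; rewrite sqr_ge0.
rewrite Ex_bucket_sq; apply: powR_sum_le => // i _.
by rewrite mulr_ge0 ?sqr_ge0// sumr_ge0// => j _; rewrite sqr_ge0.
Qed.

End SketchMoments.

(** * Upper bound for the dilated block *)

Section DilatedUpper.
Variables (R : realType) (n r K k : nat) (s : R).
Hypothesis r_gt0 : (0 < #|'I_r|)%N.
Hypotheses (s_gt0 : 0 < s) (s_lt1 : s < 1).

Definition dil (l : nat) : R := (2 ^+ l) `^ ((2 * s)^-1).

Lemma dil_sq l : dil l ^+ 2 = (2 ^+ l) `^ s^-1.
Proof.
rewrite -powR_mulrn ?powR_ge0// /dil -powRrM; congr (_ `^ _).
by field; rewrite gt_eqF.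
Qed.

Lemma pw_dil l : pw s (dil l) = 2 ^+ l.
Proof. by rewrite /pw dil_sq -powRrM mulVf ?gt_eqF// powRr1// exprn_ge0. Qed.

Definition spread := fpow 'I_n (fprod (funif R r_gt0) (levels R K)).

Definition rhash (w : {ffun 'I_n -> 'I_r * 'I_K.+1}) : {ffun 'I_n -> 'I_r} :=
  [ffun i => (w i).1].
Definition rlev (w : {ffun 'I_n -> 'I_r * 'I_K.+1}) i : 'I_K.+1 := (w i).2.

Lemma Ex_rlev i (g : 'I_K.+1 -> R) :
  Ex spread (fun w => g (rlev w i)) = Ex (levels R K) g.
Proof.
rewrite (Ex_fpow1 _ i (fun p => g p.2)).
by rewrite (Ex_fprod _ _ (fun _ l => g l)) Ex_cst.
Qed.

Variable u : 'I_n -> 'I_k -> R.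
Let q i := \sum_j u i j ^+ 2.
Let wt i := q i `^ s.

Let q_ge0 i : 0 <= q i.
Proof. by apply: sumr_ge0 => j _; rewrite sqr_ge0. Qed.

Let qE i : q i = wt i `^ s^-1.
Proof. by rewrite /wt -powRrM divff ?gt_eqF// powRr1. Qed.

Let csm i (l : nat) : R := (wt i * 2 ^+ l <= 1)%R%:R * dil l.
Let clg t i (l : nat) : R :=
  ((1 < wt i * 2 ^+ l)%R && (wt i * 2 ^+ l <= 2 ^+ t)%R)%:R * dil l.

Definition csmall : R := (1 - 2 `^ (- (s^-1 - 1)))^-1.

Lemma csmall_gt0 : 0 < csmall.
Proof.
rewrite invr_gt0 subr_gt0 powRN invf_lt1 ?powR_gt0// powR_gt1// ?ltr1n//.
by rewrite subr_gt0 invf_gt1.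
Qed.

(** The value of a bucket is the inner product of [x] with a random vector, so Cauchy-Schwarz
    reduces the bound for all [x] to the norms of these vectors, where Markov applies. Small
    dilations are bounded in l2 and pay [r^(1 - s)], large ones directly in l_p. *)
Lemma dilated_upper (d : R) (t : nat) : 1 <= d -> \sum_i wt i <= d ->
  1000 * d <= 2 ^+ t ->
  Pr (fprod (signs R n) spread) (fun w => ~ forall x : 'I_k -> R,
    \sum_b pw s (bucket w.1 (rhash w.2)
       (fun i => dil (rlev w.2 i) * \sum_j u i j * x j) b) <=
    2 * (r%:R `^ (1 - s) * (1000 * csmall * d) `^ s + 1000 * t%:R * d) *
      (\sum_j x j ^+ 2) `^ s) <= 3 / 1000.
Proof.
move=> d1 hd ht; have d0 : 0 < d by lra.
have wt0 i : 0 <= wt i by apply: powR_ge0.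
have t0 : (0 < t)%N.
  by rewrite lt0n; apply/eqP => te; move: ht; rewrite te expr0; lra.
have tp : (0 : R) < t%:R by rewrite ltr0n.
pose Vs e w b j := bucket e (rhash w) (fun i => csm i (rlev w i) * u i j) b.
pose Vl e w b j := bucket e (rhash w) (fun i => clg t i (rlev w i) * u i j) b.
pose fs (w : {ffun 'I_n -> bool} * {ffun 'I_n -> 'I_r * 'I_K.+1}) :=
  \sum_b \sum_j Vs w.1 w.2 b j ^+ 2.
pose fl (w : {ffun 'I_n -> bool} * {ffun 'I_n -> 'I_r * 'I_K.+1}) :=
  \sum_b (\sum_j Vl w.1 w.2 b j ^+ 2) `^ s.
have fs0 w : 0 <= fs w.
  by apply: sumr_ge0 => b _; apply: sumr_ge0 => j _; rewrite sqr_ge0.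
have fl0 w : 0 <= fl w by apply: sumr_ge0 => b _; apply: powR_ge0.
(* The row weights sum to at most [d], so the tails [w / T] at [T = 1000 d] sum to at most
   [1/1000]. *)
pose B1 (w : {ffun 'I_n -> bool} * {ffun 'I_n -> 'I_r * 'I_K.+1}) :=
  exists i, 1000 * d < wt i * 2 ^+ rlev w.2 i.
have P1 : Pr (fprod (signs R n) spread) B1 <= 1 / 1000.
  rewrite (Pr_fprodr _ _ (fun w => exists i, 1000 * d < wt i * 2 ^+ rlev w i)).
  apply: le_trans (Pr_exists _ _) _.
  apply: (@le_trans _ _ (\sum_i wt i / (1000 * d))); last first.
    by rewrite -mulr_suml ler_pdivrMr; lra.
  apply: ler_sum => i _.
  rewrite /Pr (Ex_rlev i (fun l => `[< 1000 * d < wt i * 2 ^+ l >]%:R)).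
  by apply: level_tail_lt => //; lra.
have P2 : Pr (fprod (signs R n) spread) (fun w => 1000 * csmall * d < fs w) <= 1 / 1000.
  apply: markov => //.
    by rewrite !mulr_gt0 ?csmall_gt0.
  rewrite (Ex_fprod _ _ (fun e w => \sum_b \sum_j Vs e w b j ^+ 2)) Ex_exchange.
  under eq_Ex do rewrite Ex_sketch_sq.
  rewrite Ex_sum; apply: (@le_trans _ _ (\sum_i csmall * wt i)); last first.
    by rewrite -mulr_sumr; have := csmall_gt0; nra.
  apply: ler_sum => i _; rewrite (Ex_rlev i (fun l => csm i l ^+ 2 * q i)).
  apply: le_trans _ (Ex_level_small K (wt0 i) s_gt0 s_lt1).
  apply: Ex_le => l; rewrite /csm.
  case: (_ <= 1)%R; first by rewrite !mul1r dil_sq qE -powRM ?exprn_ge0// mulrC.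
  by rewrite !mul0r expr0n mul0r.
have P3 : Pr (fprod (signs R n) spread) (fun w => 1000 * t%:R * d < fl w) <= 1 / 1000.
  apply: markov => //.
    by rewrite !mulr_gt0.
  rewrite (Ex_fprod _ _ (fun e w => \sum_b (\sum_j Vl e w b j ^+ 2) `^ s)) Ex_exchange.
  apply: (@le_trans _ _ (Ex spread (fun w => \sum_i (clg t i (rlev w i) ^+ 2 * q i) `^ s))).
    by apply: Ex_le => w; apply: Ex_sketch_pw => //; apply: ltW.
  rewrite Ex_sum; apply: (@le_trans _ _ (\sum_i t%:R * wt i)); last first.
    by rewrite -mulr_sumr; nra.
  apply: ler_sum => i _; rewrite (Ex_rlev i (fun l => (clg t i l ^+ 2 * q i) `^ s)).
  apply: le_trans _ (Ex_level_large K t (wt0 i)).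
  apply: Ex_le => l; rewrite powRM ?sqr_ge0// -/(wt i) -/(pw s _) /clg pwM pw_dil.
  case: (_ && _); last by rewrite pw0// !mul0r.
  by rewrite /pw expr1n powR1 !mul1r mulrC.
have := lerD P1 (lerD P2 P3).
have -> : 1 / 1000 + (1 / 1000 + 1 / 1000) = 3 / 1000 :> R by lra.
apply: le_trans; apply: le_trans (lerD (lexx _) (Pr_or _ _ _)).
apply: le_trans (Pr_or _ _ _); apply: Pr_le => -[e w] /= bad.
apply: contrapT => /not_orP[nB1 /not_orP[/negP nB2 /negP nB3]].
rewrite -!leNgt in nB2 nB3.
apply: bad => x.
set X := \sum_j x j ^+ 2.
have X0 : 0 <= X by apply: sumr_ge0 => j _; rewrite sqr_ge0.
have split_bucket b : bucket e (rhash w) (fun i => dil (rlev w i) * \sum_j u i j * x j) b =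
    \sum_j Vs e w b j * x j + \sum_j Vl e w b j * x j.
  rewrite -big_split/= /Vs /Vl /bucket.
  under [RHS]eq_bigr do rewrite -mulrDl -big_split/= mulr_suml.
  rewrite exchange_big/=; apply: eq_bigr => i _.
  have -> : dil (rlev w i) = csm i (rlev w i) + clg t i (rlev w i).
    rewrite /csm /clg -mulrDl -natrD.
    have hw : wt i * 2 ^+ rlev w i <= 2 ^+ t.
      by apply: le_trans ht; rewrite leNgt; apply/negP => hi; apply: nB1; exists i.
    by rewrite hw andbT; case: lerP; rewrite ?addn0 ?add0n mul1r.
  by rewrite !mulr_sumr; apply: eq_bigr => j _; ring.
have cs (V : 'I_k -> R) : pw s (\sum_j V j * x j) <= (\sum_j V j ^+ 2) `^ s * X `^ s.
  have V0 : 0 <= \sum_j V j ^+ 2 by apply: sumr_ge0 => j _; rewrite sqr_ge0.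
  rewrite -powRM//; apply: ge0_ler_powR; rewrite ?nnegrE ?(ltW s_gt0) ?sqr_ge0//.
    by rewrite mulr_ge0.
  exact: cauchy_schwarz.
apply: (@le_trans _ _ (\sum_b 2 * ((\sum_j Vs e w b j ^+ 2) `^ s * X `^ s + (\sum_j Vl e w b j ^+ 2) `^ s * X `^ s))).
  apply: ler_sum => b _; rewrite split_bucket.
  apply: le_trans (pw_add _ _ s_gt0 (ltW s_lt1)) _.
  by rewrite ler_wpM2l// lerD.
rewrite -mulr_sumr -mulrA ler_wpM2l// big_split/= -!mulr_suml -mulrDl.
rewrite ler_wpM2r ?powR_ge0// lerD//.
apply: le_trans (powR_mean s_gt0 (ltW s_lt1) _) _.
  by move=> b; apply: sumr_ge0 => j _; rewrite sqr_ge0.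
rewrite card_ord ler_wpM2l ?powR_ge0//.
apply: ge0_ler_powR; rewrite ?nnegrE ?(ltW s_gt0)//; first exact: (fs0 (e, w)).
by rewrite !mulr_ge0 ?(ltW csmall_gt0) ?(ltW d0).
Qed.

End DilatedUpper.

(** * Small balls for flat vectors *)

Section SmallBall.
Variables (R : realType) (n r K : nat) (s : R).
Hypothesis r_gt0 : (0 < #|'I_r|)%N.
Hypothesis s_gt0 : 0 < s.
Variables (y : 'I_n -> R) (tau : R).
Hypothesis tau_gt0 : 0 < tau.

Let W := {ffun 'I_n -> 'I_r * 'I_K.+1}.

Definition fires (w : W) i := tau <= pw s (y i) * 2 ^+ rlev w i.
Definition occupied (w : W) b := [exists i, (rhash w i == b) && fires w i].
Definition bval (e : {ffun 'I_n -> bool}) (w : W) b : R :=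
  bucket e (rhash w) (fun i => dil s (rlev w i) * y i) b.
(** Markov's inequality is applied to the product of these weights over all buckets, which is small only if few buckets carry mass [tau]. *)
Definition gweight (x : R) : R := if tau <= pw s x then 8^-1 else 1.

Section Flip.
Variable w : W.

(** Flipping the sign of one fired coordinate per occupied bucket randomises the buckets independently, and one of the two signs makes the bucket heavy. *)
Let rep b := [pick i | (rhash w i == b) && fires w i].

Let flip (z : {ffun 'I_r -> bool}) (e : {ffun 'I_n -> bool}) : {ffun 'I_n -> bool} :=
  [ffun i => e i (+) ((rep (rhash w i) == Some i) && z (rhash w i))].

Let flipK z : involutive (flip z).
Proof. by move=> e; apply/ffunP => i; rewrite !ffunE -addbA addbb addbF. Qed.

Let Ex_flip z (F : {ffun 'I_n -> bool} -> R) :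
  Ex (signs R n) F = Ex (signs R n) (fun e => F (flip z e)).
Proof.
rewrite /Ex (reindex_inj (inv_inj (flipK z)))/=.
by apply: eq_bigr => e _; congr (_ * _).
Qed.

Let bflip e b (c : bool) : R :=
  \sum_(i | rhash w i == b)
    sg R e i * (-1) ^+ ((rep b == Some i) && c) * (dil s (rlev w i) * y i).

Let bval_flip z e b : bval (flip z e) w b = bflip e b (z b).
Proof.
apply: eq_bigr => i /eqP hi; rewrite /sg !ffunE; congr (_ * _).
by rewrite -hi !ffunE signr_addb.
Qed.

Let bflip_good e b : occupied w b ->
  gweight (bflip e b false) + gweight (bflip e b true) <= 8^-1 + 1.
Proof.
move=> /existsP[i0 hi0]; rewrite /gweight.
have [i [repi hib fi]] : exists i, [/\ rep b = Some i, rhash w i = b & fires w i].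
  rewrite /rep; case: pickP => [i /andP[/eqP hib fi]|/(_ i0)]; first by exists i.
  by rewrite hi0.
set t : R := sg R e i * (dil s (rlev w i) * y i).
have pt : tau <= pw s t.
  by rewrite /t pwM {1}/pw sg_sq powR1 mul1r pwM (pw_dil s_gt0) mulrC.
pose rest := \sum_(j | (rhash w j == b) && (j != i)) sg R e j * (dil s (rlev w j) * y j).
have e1 c : bflip e b c = (-1) ^+ c * t + rest.
  rewrite /bflip (bigD1 i)/= ?hib// repi eqxx /= /t; congr (_ + _); first by ring.
  apply: eq_bigr => j /andP[_ ji]; rewrite (_ : (Some i == Some j) = false) ?expr0 ?mulr1//.
  by apply/eqP => -[ij]; move: ji; rewrite ij eqxx.
have big x : t ^+ 2 <= x ^+ 2 -> tau <= pw s x.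
  move=> tx; apply: le_trans pt _; apply: ge0_ler_powR => //; rewrite ?nnegrE ?sqr_ge0//.
  exact: ltW.
have [h|h] := leP (t ^+ 2) ((bflip e b false) ^+ 2).
  by rewrite (big _ h) lerD2l; case: ifP => _; lra.
have h' : t ^+ 2 <= (bflip e b true) ^+ 2.
  by move: h; rewrite !e1 expr0 expr1; have := sqr_ge0 rest; nra.
by rewrite (big _ h') addrC lerD2l; case: ifP => _; lra.
Qed.

(** Flips preserve the law of the signs, and for fixed [e] the product factorises over the buckets.
    Over its own flip an occupied bucket has mean weight at most [(1/8 + 1) / 2 = 9/16]. *)
Lemma Ex_signs_good :
  Ex (signs R n) (fun e => \prod_b gweight (bval e w b)) <=
  \prod_b (if occupied w b then 9 / 16 else 1).
Proof.
have g0 x : 0 <= gweight x by rewrite /gweight; case: ifP => _; lra.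
have -> : Ex (signs R n) (fun e => \prod_b gweight (bval e w b)) =
    Ex (signs R r) (fun z => Ex (signs R n) (fun e => \prod_b gweight (bflip e b (z b)))).
  rewrite -[LHS](Ex_cst (signs R r)); apply: eq_Ex => z; rewrite (Ex_flip z).
  by apply: eq_Ex => e; apply: eq_bigr => b _; rewrite bval_flip.
rewrite Ex_exchange -[leRHS](Ex_cst (signs R n)); apply: Ex_le => e.
rewrite (Ex_fpow_prod _ (fun b c => gweight (bflip e b c))).
apply: ler_prod => b _; rewrite Ex_ge0//= Ex_funif big_bool card_bool/=.
case: ifP => [/(bflip_good e)|_]; first by lra.
have le1 x : gweight x <= 1 by rewrite /gweight; case: ifP => _; lra.
by have := le1 (bflip e b true); have := le1 (bflip e b false); lra.
Qed.

End Flip.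

Let bernw (b : bool) : R := if b then 7 / 16 else 9 / 16.
Fact bernw_ge0 b : 0 <= bernw b. Proof. by rewrite /bernw; case: b; lra. Qed.
Fact bernw_sum : \sum_b bernw b = 1. Proof. by rewrite big_bool /bernw/=; lra. Qed.
Let bern := FDist bernw_ge0 bernw_sum.

(** Expanding [prod_b (9/16 + 7/16 * ~~ occupied b)] as the expectation over a random set [B] of buckets turns the integrand into the event that no fired coordinate falls into [B], whose probability factorises over the coordinates. *)
Lemma Ex_occupied : 4 * r%:R <= \sum_i Pr (levels R K) (fun l => tau <= pw s (y i) * 2 ^+ l) ->
  Ex (spread R n K r_gt0) (fun w => \prod_b (if occupied w b then 9 / 16 else 1)) <=
  (151 / 256) ^+ r.
Proof.
pose P i := Pr (levels R K) (fun l => tau <= pw s (y i) * 2 ^+ l).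
move=> hP; have {}hP : 4 * r%:R <= \sum_i P i := hP.
have rp : (0 : R) < r%:R by move: r_gt0; rewrite card_ord ltr0n.
pose avoid (B : {ffun 'I_r -> bool}) (w : W) : R :=
  \prod_i (1 - (fires w i && B (rhash w i))%:R).
apply: (@le_trans _ _ (Ex (spread R n K r_gt0) (fun w => Ex (fpow 'I_r bern) (fun B => avoid B w)))).
  apply: Ex_le => w.
  have -> : \prod_b (if occupied w b then 9 / 16 else 1) =
      Ex (fpow 'I_r bern) (fun B => \prod_b (if B b then (~~ occupied w b)%:R else 1)).
    rewrite (Ex_fpow_prod _ (fun b (c : bool) => if c then (~~ occupied w b)%:R else 1)).
    by apply: eq_bigr => b _; rewrite /Ex big_bool /= /bernw; case: occupied => /=; lra.
  apply: Ex_le => B; rewrite /avoid.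
  case: (boolP [exists i, fires w i && B (rhash w i)]) => [/existsP[i /andP[fi Bi]]|].
    rewrite (bigD1 (rhash w i))//= Bi (_ : occupied w _) ?mul0r; last first.
      by apply/existsP; exists i; rewrite eqxx.
    by apply: prodr_ge0 => j _; rewrite subr_ge0 lern1 leq_b1.
  rewrite negb_exists => /forallP h; rewrite [leRHS]big1 => [|i _]; last first.
    by rewrite (negbTE (h i)) subr0.
  by apply: prodr_ile1 => b _; case: (B b); case: occupied => /=; rewrite ?ler01 ?lexx.
rewrite Ex_exchange.
(* For fixed [B] no coordinate fires into [B] with probability [prod (1 - P_i |B| / r) <= exp (- 4
   |B|) <= 16^-|B|]. Averaging over [B] gives [7/16 * 1/16 + 9/16 = 151/256] per bucket. *)
apply: (@le_trans _ _ (Ex (fpow 'I_r bern) (fun B => \prod_b (if B b then 1 / 16 else 1)))); last first.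
  rewrite (Ex_fpow_prod _ (fun b (c : bool) => if c then 1 / 16 else 1)).
  under eq_bigr do rewrite /Ex big_bool /= /bernw.
  rewrite prodr_const card_ord.
  by rewrite (_ : 7 / 16 * (1 / 16) + 9 / 16 * 1 = 151 / 256)//; lra.
apply: Ex_le => B.
pose N : R := \sum_b (B b)%:R.
have N0 : 0 <= N by apply: sumr_ge0.
have NE : Ex (funif R r_gt0) (fun b => (B b)%:R) = N / r%:R.
  by rewrite Ex_funif card_ord mulrC.
have -> : Ex (spread R n K r_gt0) (fun w => avoid B w) = \prod_i (1 - P i * (N / r%:R)).
  rewrite -NE /avoid.
  transitivity (Ex (spread R n K r_gt0) (fun w => \prod_i
     (1 - (`[< tau <= pw s (y i) * 2 ^+ (w i).2 >] && B (w i).1)%:R : R))).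
    apply: eq_Ex => w; apply: eq_bigr => i _; rewrite /fires /rlev ffunE.
    by case: (asboolP (tau <= _)) => [->//|/negP/negbTE->].
  rewrite (Ex_fpow_prod _ (fun i (p : 'I_r * 'I_K.+1) =>
    1 - (`[< tau <= pw s (y i) * 2 ^+ p.2 >] && B p.1)%:R)).
  apply: eq_bigr => i _.
  rewrite (Ex_fprod _ _ (fun b (l : 'I_K.+1) => 1 - (`[< tau <= pw s (y i) * 2 ^+ l >] && B b)%:R)).
  transitivity (Ex (funif R r_gt0) (fun b => 1 + (- P i) * (B b)%:R)).
    apply: eq_Ex => b.
    transitivity (Ex (levels R K) (fun l => 1 + - (B b)%:R * `[< tau <= pw s (y i) * 2 ^+ l >]%:R)).
      by apply: eq_Ex => l; case: `[< _ >]; case: (B b); rewrite /= ?mulr1 ?mulr0 ?oppr0.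
    by rewrite ExD Ex_cst ExZ -/(Pr _ _) -/(P i) mulNr mulrC mulNr.
  by rewrite ExD Ex_cst ExZ mulNr.
apply: (@le_trans _ _ (\prod_i expR (- (P i * (N / r%:R))))).
  apply: ler_prod => i _; rewrite expR_ge1Dx andbT subr_ge0.
  apply: mulr_ile1; rewrite ?Pr_ge0 ?divr_ge0 ?(ltW rp)//.
    by rewrite /P -(Pr_true (levels R K)); apply: Pr_le.
  rewrite ler_pdivrMr// mul1r; apply: (@le_trans _ _ (\sum_(b : 'I_r) 1)).
    by apply: ler_sum => b _; case: (B b).
  by rewrite sumr_const card_ord.
rewrite -expR_sum sumrN -mulr_suml.
apply: (@le_trans _ _ (expR (- (4 * N)))).
  rewrite ler_expR lerN2 mulrA ler_pdivlMr// -mulrA [N * _]mulrC mulrA ler_wpM2r//.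
rewrite /N mulr_sumr -sumrN expR_sum; apply: ler_prod => b _; rewrite expR_ge0/=.
case: (B b); last by rewrite mulr0 oppr0 expR0.
rewrite expRN expRM_natl.
have h : 2 <= expR 1 :> R by have := @expR_ge1Dx R 1; lra.
have h4 : 16 <= expR 1 ^+ 4 :> R.
  have -> : 16 = 2 ^+ 4 :> R by ring.
  by apply: lerXn2r; rewrite ?nnegrE ?expR_ge0.
by rewrite mul1r lef_pV2 ?posrE ?exprn_gt0 ?expR_gt0//; lra.
Qed.

(** A coordinate of mass [m] in the given range fires with probability at least [m / (2 tau)], so
    the hypothesis yields four expected hits per bucket. If the sketch is small, at most [r / 16]
    buckets are heavy, which keeps the product of the weights above a threshold. *)
Lemma small_ball :
  8 * tau * r%:R <= \sum_(i | (pw s (y i) <= tau) && (tau <= pw s (y i) * 2 ^+ K)) pw s (y i) ->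
  Pr (fprod (signs R n) (spread R n K r_gt0)) (fun w =>
    16 * \sum_b pw s (bval w.1 w.2 b) <= r%:R * tau) <= (7 / 10) ^+ r.
Proof.
move=> hy.
have hP : 4 * r%:R <= \sum_i Pr (levels R K) (fun l => tau <= pw s (y i) * 2 ^+ l).
  have : 4 * r%:R <= \sum_(i | (pw s (y i) <= tau) && (tau <= pw s (y i) * 2 ^+ K)) pw s (y i) / (2 * tau).
    by rewrite -mulr_suml ler_pdivlMr ?mulr_gt0//; lra.
  move=> /le_trans; apply; rewrite big_mkcond/=; apply: ler_sum => i _.
  case: ifP => [/andP[h1 h2]|_]; last exact: Pr_ge0.
  apply: level_tail_ge => //.
  rewrite lt_def pw_ge0 andbT; apply/eqP => h0; move: h2; rewrite h0 mul0r.
  by rewrite leNgt tau_gt0.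
pose f (w : {ffun 'I_n -> bool} * W) := \prod_b gweight (bval w.1 w.2 b).
have f0 w : 0 <= f w.
  by apply: prodr_ge0 => b _; rewrite /gweight; case: ifP => _; lra.
(* The threshold rests on [(87/100)^16 <= 1/8] and [151/256 <= 7/10 * 87/100]. *)
have c0 : (0 : R) < (87 / 100) ^+ r by rewrite exprn_gt0//; lra.
apply: (markov_le c0 f0); last first.
  rewrite (Ex_fprod _ _ (fun e w => \prod_b gweight (bval e w b))) Ex_exchange.
  apply: le_trans (Ex_le _ (fun w => Ex_signs_good w)) _.
  apply: le_trans (Ex_occupied hP) _.
  by rewrite -exprMn; apply: lerXn2r; rewrite ?nnegrE; lra.
have a0 : (0 : R) <= 87 / 100 by lra.
have a1 : (87 / 100 : R) <= 1 by lra.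
have a16 : (87 / 100 : R) ^+ 16 <= 8^-1.
  have -> : (87 / 100 : R) ^+ 16 = ((87 / 100) ^+ 4) ^+ 4 by rewrite -exprM.
  have h1 : (87 / 100 : R) ^+ 4 <= 58 / 100 by lra.
  apply: (@le_trans _ _ ((58 / 100) ^+ 4)); last by lra.
  by apply: lerXn2r => //; rewrite nnegrE; lra.
move=> [e w]/= small; rewrite /f/=.
pose G := [set b | tau <= pw s (bval e w b)].
have fE : \prod_b gweight (bval e w b) = 8^-1 ^+ #|G|.
  rewrite /gweight -big_mkcond/= prodr_const; congr (_ ^+ _).
  by apply: eq_card => b; rewrite inE.
have hG : (16 * #|G| <= r)%N.
  rewrite -(ler_nat R) natrM -(ler_pM2r tau_gt0); apply: le_trans small.
  rewrite -mulrA ler_wpM2l//.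
  rewrite mulr_natl -sumr_const.
  rewrite big_mkcond/=; apply: ler_sum => b _; rewrite inE.
  by case: ifP => // _; apply: pw_ge0.
rewrite fE; apply: (@le_trans _ _ ((87 / 100) ^+ (16 * #|G|))).
  exact: (ler_wiXn2l a0 a1 hG).
rewrite exprM; apply: lerXn2r; rewrite ?nnegrE ?invr_ge0//.
by rewrite exprn_ge0.
Qed.

End SmallBall.

(** * CountSketch on a subspace *)

(** The constant in [(1200 d)^2] makes each of the three exceptional events below have probability at most [1/1000]. *)
Section CountSketchBlock.
Variables (R : realType) (n k d : nat) (s : R).
Hypotheses (s_ge : 2^-1 <= s) (s_lt1 : s < 1) (d_gt0 : (0 < d)%N).

Let r := ((1200 * d) ^ 2)%N.

Fact block1_rows_gt0 : (0 < #|'I_((1200 * d) ^ 2)|)%N.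
Proof. by rewrite card_ord expn_gt0 muln_gt0 d_gt0. Qed.

Let hs := hashes R n block1_rows_gt0.
Let D : R := d%:R.
Let D1 : 1 <= D. Proof. by rewrite ler1n. Qed.
Let D0 : 0 < D. Proof. by rewrite ltr0n. Qed.
Let s_gt0 : 0 < s. Proof. by apply: lt_le_trans s_ge; rewrite invr_gt0. Qed.
Let rE : r%:R = 1200 ^+ 2 * D ^+ 2 :> R.
Proof. by rewrite /r natrX natrM exprMn. Qed.

Variable u : 'I_n -> 'I_k -> R.
Let lin (x : 'I_k -> R) i := \sum_a u i a * x a.
Let q i := \sum_j u i j ^+ 2.

(** An error of [1/24] relative to [|x|^2] is one of [12/24 = 1/2] relative to the vector itself. *)
Lemma block1_lower :
  \sum_i q i <= D ->
  (forall x, \sum_j x j ^+ 2 <= 12 * \sum_i lin x i ^+ 2) ->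
  Pr (fprod hs (signs R n)) (fun w => ~ forall x,
    2^-1 * \sum_i lin x i ^+ 2 <= \sum_b bucket w.2 w.1 (lin x) b ^+ 2) <= 1 / 1000.
Proof.
move=> hq hx; apply: le_trans (sketch_norm_concentration (u := u) (eps := 24^-1) (delta := 1 / 1000) block1_rows_gt0 _ hq _);
  last first.
- rewrite -/r rE ler_pdivrMr; last by rewrite mulr_gt0// exprn_gt0.
  have -> : 1 / 1000 * 24^-1 ^+ 2 * (1200 ^+ 2 * D ^+ 2) = 25 / 10 * D ^+ 2 :> R by field.
  by have := sqr_ge0 D; lra.
- by rewrite invr_gt0.
apply: Pr_le => w /= bad good; apply: bad => x.
have /= := good x; rewrite ler_norml => /andP[h _].
by have := hx x; move: h; rewrite -/(lin x); lra.
Qed.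

Let wt i := q i `^ s.

(** Heavy rows lose [D^s] through bucket loads [O(D)]. Light rows are measured in l2; converting
    back costs [(D^2)^(1 - s)], against which their smallness gains [beta^s = D^-(1 - s)]. The
    product [D^(1 - s)] is at most [D^s] since [p >= 1]. *)
Lemma block1_upper :
  \sum_i wt i <= D ->
  (forall x, (\sum_j x j ^+ 2) `^ s <= 12 * \sum_i pw s (lin x i)) ->
  Pr (fprod hs (signs R n)) (fun w => ~ forall x,
    \sum_b pw s (bucket w.2 w.1 (lin x) b) <=
      2 * (50 + 156 * 1200 ^+ 2) * D `^ s * \sum_i pw s (lin x i)) <= 2 / 1000.
Proof.
move=> hw hx.
have q0 i : 0 <= q i by apply: sumr_ge0 => j _; rewrite sqr_ge0.
have qE i : q i = wt i `^ s^-1 by rewrite /wt -powRrM divff ?gt_eqF// powRr1.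
have wt0 i : 0 <= wt i by apply: powR_ge0.
have is1 : 1 < s^-1 by rewrite invf_gt1.
have is2 : s^-1 <= 2 by rewrite -[2]invrK lef_pV2 ?posrE ?invr_gt0.
have is3 : s^-1 - 1 <= 1 by lra.
have is4 : 0 <= s^-1 - 1 by lra.
have is5 : 1 - s <= s by rewrite lerBlDr [leLHS](splitr 1) mul1r lerD.
pose H i := D^-1 < wt i.
pose beta := D^-1 `^ (s^-1 - 1).
have b0 : 0 < beta by rewrite powR_gt0// invr_gt0.
pose uL i j := (~~ H i)%:R * u i j.
have qL : \sum_i \sum_j uL i j ^+ 2 <= D * beta.
  rewrite [leRHS]mulrC -ler_pdivrMl//.
  apply: le_trans hw; rewrite mulr_sumr; apply: ler_sum => i _.
  rewrite ler_pdivrMl//.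
  have -> : \sum_j uL i j ^+ 2 = (~~ H i)%:R * q i.
    rewrite /q mulr_sumr; apply: eq_bigr => j _; rewrite /uL exprMn.
    by case: (~~ H i); rewrite ?expr1n ?expr0n.
  case: (boolP (H i)) => /= hi; first by rewrite mul0r mulr_ge0// ltW.
  rewrite mul1r qE -(mulr_powRB1 (wt0 i) (_ : 0 < s^-1)) ?invr_gt0//.
  rewrite mulrC ler_wpM2r//; apply: ge0_ler_powR; rewrite ?nnegrE ?invr_ge0 ?(ltW D0)//.
  by rewrite leNgt.
have P2 : Pr (fprod hs (signs R n)) (fun w => (50 * D) ^+ 2 <
    \sum_b (\sum_(i | w.1 i == b) (H i)%:R) ^+ 2) <= 1 / 1000.
  apply: markov.
  - by rewrite exprn_gt0// mulr_gt0.
  - by move=> w; apply: sumr_ge0 => b _; rewrite sqr_ge0.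
  rewrite (Ex_fprod _ _ (fun (h : {ffun 'I_n -> 'I_r}) (_ : {ffun 'I_n -> bool}) => \sum_b (\sum_(i | h i == b) (H i)%:R) ^+ 2)).
  under eq_Ex do rewrite Ex_cst.
  apply: le_trans (Ex_load _ (fun i => ler0n _ (H i))) _.
  rewrite -/r rE.
  have HD : \sum_i (H i)%:R <= D ^+ 2.
    rewrite expr2; apply: le_trans (ler_wpM2l (ltW D0) hw); rewrite mulr_sumr.
    apply: ler_sum => i _; case: (boolP (H i)) => [hi|_]; last by rewrite mulr_ge0// ltW.
    by rewrite -ler_pdivrMl// mulr1 ltW.
  have -> : \sum_i (H i)%:R ^+ 2 = \sum_i (H i)%:R :> R.
    by apply: eq_bigr => i _; case: (H i); rewrite ?expr1n ?expr0n.
  have H0 : 0 <= \sum_i (H i)%:R :> R by apply: sumr_ge0.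
  have : (\sum_i (H i)%:R) ^+ 2 / (1200 ^+ 2 * D ^+ 2) <= D ^+ 2.
    rewrite ler_pdivrMr; last by rewrite mulr_gt0// exprn_gt0.
    apply: (@le_trans _ _ ((D ^+ 2) ^+ 2)); first by apply: lerXn2r; rewrite ?nnegrE ?sqr_ge0.
    by rewrite expr2 mulrCA; have := sqr_ge0 (D ^+ 2); rewrite expr2; lra.
  have D20 := sqr_ge0 D.
  by rewrite exprMn; lra.
have P3 : Pr (fprod hs (signs R n)) (fun w => ~ forall x,
    `|\sum_b (bucket w.2 w.1 (fun i => \sum_a uL i a * x a) b) ^+ 2 -
      \sum_i (\sum_a uL i a * x a) ^+ 2| <= beta * \sum_a x a ^+ 2) <= 1 / 1000.
  apply: (sketch_norm_concentration block1_rows_gt0 b0 qL); rewrite -/r rE ler_pdivrMr; last by rewrite mulr_gt0// exprn_gt0.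
  have -> : 1 / 1000 * beta ^+ 2 * (1200 ^+ 2 * D ^+ 2) = 1440 * (D * beta) ^+ 2 by field.
  by have := sqr_ge0 (D * beta); lra.
have := lerD P2 P3; rewrite -mulrDl.
apply: le_trans; apply: le_trans (Pr_or _ _ _); apply: Pr_le => -[h e] /= bad.
apply: contrapT => /not_orP[/negP nB2 /contrapT good].
rewrite -leNgt in nB2; apply: bad => x.
set N := \sum_i pw s (lin x i).
have N0 : 0 <= N by apply: sumr_ge0 => i _; apply: pw_ge0.
set X := \sum_j x j ^+ 2 in hx *.
have X0 : 0 <= X by apply: sumr_ge0 => j _; rewrite sqr_ge0.
have hX : X `^ s <= 12 * N := hx x.
have NE : N * N `^ (s^-1 - 1) = N `^ s^-1 by rewrite mulr_powRB1// invr_gt0.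
have Ns0 : 0 <= N `^ (s^-1 - 1) by apply: powR_ge0.
have XE : X <= 144 * N `^ s^-1.
  have -> : X = (X `^ s) `^ s^-1 by rewrite -powRrM divff ?gt_eqF// powRr1.
  apply: le_trans (ge0_ler_powR _ _ _ hX) _; rewrite ?nnegrE ?powR_ge0 ?mulr_ge0 ?invr_ge0 ?(ltW s_gt0)//.
  rewrite powRM// ler_wpM2r ?powR_ge0//.
  have -> : 144 = 12 `^ 2%:R :> R by rewrite powR_mulrn//; ring.
  by apply: ler_powR => //; rewrite ler1n.
pose yL i := \sum_a uL i a * x a.
have yLE i : yL i = (~~ H i)%:R * lin x i.
  by rewrite /yL /lin mulr_sumr; apply: eq_bigr => a _; rewrite /uL mulrA.
have yL2 : \sum_i yL i ^+ 2 <= 12 * beta * N `^ s^-1.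
  rewrite -NE mulrCA mulr_suml; apply: ler_sum => i _; rewrite yLE exprMn.
  case: (boolP (H i)) => /= hi.
    by rewrite expr0n mul0r !mulr_ge0 ?pw_ge0 ?(ltW b0).
  rewrite expr1n mul1r.
  have a0 := pw_ge0 s (lin x i).
  have -> : lin x i ^+ 2 = pw s (lin x i) `^ s^-1.
    by rewrite /pw -powRrM divff ?gt_eqF// powRr1// sqr_ge0.
  rewrite -(mulr_powRB1 a0 (_ : 0 < s^-1)) ?invr_gt0// ler_wpM2l//.
  (* A light coordinate is small for every [x]: its row weight is at most [1 / D], and
     [X^s <= 12 N]. *)
  have ale : pw s (lin x i) <= D^-1 * (12 * N).
    apply: (@le_trans _ _ (wt i * X `^ s)).
      rewrite -powRM//; apply: ge0_ler_powR; rewrite ?nnegrE ?(ltW s_gt0) ?sqr_ge0//.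
        by rewrite mulr_ge0.
      exact: cauchy_schwarz.
    by apply: ler_pM; rewrite ?powR_ge0// leNgt.
  apply: le_trans (ge0_ler_powR _ _ _ ale) _; rewrite ?nnegrE//.
    by rewrite !mulr_ge0// invr_ge0 ltW.
  rewrite powRM ?mulr_ge0 ?invr_ge0 ?(ltW D0)// powRM// -/beta.
  rewrite [12 * beta]mulrC -mulrA ler_wpM2l ?(ltW b0)// ler_wpM2r//.
  by apply: ler1_powR; first rewrite ler1n.
(* The sketching error contributes 144, from [12^(1/s) <= 12^2], and the norm itself 12. *)
have SL2 : \sum_b bucket e h yL b ^+ 2 <= 156 * beta * N `^ s^-1.
  have /= := good x; rewrite ler_norml => /andP[_]; rewrite -/X -/yL.
  rewrite lerBlDr => /le_trans; apply.
  have h1 : beta * X <= beta * (144 * N `^ s^-1) by rewrite ler_wpM2l// ltW.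
  apply: le_trans (lerD h1 yL2) _.
  by rewrite mulrCA -mulrA -mulrDl -mulrA -natrD.
have split_y b : bucket e h (lin x) b =
    bucket e h (fun i => (H i)%:R * lin x i) b + bucket e h yL b.
  rewrite /bucket -big_split/=; apply: eq_bigr => i _; rewrite yLE.
  by case: (H i); rewrite /= ?mul1r ?mul0r ?mulr0 ?addr0 ?add0r.
have heavy : \sum_b pw s (bucket e h (fun i => (H i)%:R * lin x i) b) <= 50 * D `^ s * N.
  apply: le_trans (load_pw e (lin x) s_gt0 (ltW s_lt1) _ nB2) _.
    by rewrite mulr_ge0// ltW.
  rewrite -/N powRM// ?(ltW D0)// ler_wpM2r// ler_wpM2r ?powR_ge0//.
  by apply: ler1_powR; [rewrite ler1n|exact: ltW].
have light : \sum_b pw s (bucket e h yL b) <= 156 * 1200 ^+ 2 * D `^ s * N.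
  apply: le_trans (powR_mean s_gt0 (ltW s_lt1) _) _; first by move=> b; rewrite sqr_ge0.
  rewrite card_ord -/r rE.
  have : (\sum_b bucket e h yL b ^+ 2) `^ s <= (156 * beta * N `^ s^-1) `^ s.
    apply: ge0_ler_powR; rewrite ?nnegrE ?(ltW s_gt0)// ?mulr_ge0 ?powR_ge0 ?(ltW b0)//.
    by apply: sumr_ge0 => b _; rewrite sqr_ge0.
  have -> : (156 * beta * N `^ s^-1) `^ s = 156 `^ s * beta `^ s * N.
    rewrite powRM ?powR_ge0 ?mulr_ge0 ?(ltW b0)// powRM ?(ltW b0)// -powRrM.
    by rewrite mulVf ?gt_eqF// powRr1.
  move=> /(ler_wpM2l (powR_ge0 (1200 ^+ 2 * D ^+ 2) (1 - s)))/le_trans; apply.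
  have -> : (1200 ^+ 2 * D ^+ 2) `^ (1 - s) * (156 `^ s * beta `^ s * N) =
     156 `^ s * (1200 ^+ 2) `^ (1 - s) * ((D ^+ 2) `^ (1 - s) * beta `^ s) * N.
    by rewrite powRM ?sqr_ge0//; ring.
  rewrite ler_wpM2r//; apply: ler_pM; rewrite ?mulr_ge0 ?powR_ge0//.
    apply: ler_pM; rewrite ?powR_ge0//.
      by apply: ler1_powR; [rewrite ler1n|exact: ltW].
    apply: ler1_powR; last by rewrite gerBl ltW.
    by rewrite -natrX ler1n expn_gt0.
  have -> : (D ^+ 2) `^ (1 - s) * beta `^ s = D `^ (1 - s).
    rewrite /beta -powR_inv1 ?(ltW D0)// -!powRrM -powR_mulrn ?(ltW D0)// -powRrM.
    rewrite -powRD; last by rewrite (gt_eqF D0) implybT.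
    by congr (_ `^ _); field; rewrite gt_eqF.
  exact: ler_powR.
apply: (@le_trans _ _ (\sum_b 2 * (pw s (bucket e h (fun i => (H i)%:R * lin x i) b) + pw s (bucket e h yL b)))).
  by apply: ler_sum => b _; rewrite split_y; apply: pw_add => //; exact: ltW.
rewrite -mulr_sumr big_split/=.
rewrite -!mulrA ler_wpM2l//; apply: le_trans (lerD heavy light) _.
by rewrite [leRHS]mulrDl !mulrA.
Qed.

End CountSketchBlock.

(** * From the net to the subspace *)

Section Net.
Variables (R : realType) (n k d G' : nat) (s : R).
Hypotheses (s_ge : 2^-1 <= s) (s_lt1 : s < 1) (k_le : (k <= d)%N).
Hypotheses (d_gt0 : (0 < d)%N) (G'_gt0 : (0 < G')%N).

Let G := (d * G')%N.

(** Grid of spacing [1 / (d G')] on [[-12, 12]], both ends included. All coordinates of a vector of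
    unit mass lie in this range because [12^(1/s) <= 12^2]. *)
Definition gridpt (g : {ffun 'I_k -> 'I_(24 * (d * G')).+1}) j : R :=
  (g j)%:R / (d * G')%:R - 12.

Lemma grid_approx (x : 'I_k -> R) : (forall j, `|x j| <= 12) ->
  exists g, forall j, (x j - gridpt g j) ^+ 2 <= G%:R^-1 ^+ 2.
Proof.
move=> hx.
have Gp : (0 : R) < G%:R by rewrite ltr0n muln_gt0 d_gt0.
pose v j := (x j + 12) * G%:R.
have v0 j : 0 <= v j.
  by have := hx j; rewrite ler_norml => /andP[h _]; rewrite mulr_ge0 ?(ltW Gp)//; lra.
have vG j : (Num.truncn (v j) < (24 * G).+1)%N.
  rewrite ltnS -(ler_nat R) natrM; have /andP[h _] := truncn_itv (v0 j).
  apply: le_trans h _; rewrite /v ler_wpM2r ?(ltW Gp)//.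
  by have := hx j; rewrite ler_norml => /andP[_ h]; lra.
exists [ffun j => Ordinal (vG j)] => j.
rewrite /gridpt ffunE /= -/G.
have /andP[h1 h2] := truncn_itv (v0 j).
have -> : x j - ((Num.truncn (v j))%:R / G%:R - 12) = (v j - (Num.truncn (v j))%:R) / G%:R.
  by rewrite /v mulrBl mulfK ?gt_eqF//; ring.
rewrite exprMn -[leRHS]mul1r ler_wpM2r ?sqr_ge0//.
by rewrite -natr1 in h2; rewrite -(expr1n _ 2); apply: lerXn2r; rewrite ?nnegrE; lra.
Qed.

Variable u : 'I_n -> 'I_k -> R.
Let lin (x : 'I_k -> R) i := \sum_a u i a * x a.
Let N (y : 'I_n -> R) := \sum_i pw s (y i).

(** [Phi] plays the role of [x |-> ||Pi U x||_p^p], which satisfies the triangle inequality up to a factor [2]. *)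
Lemma net_lower (Phi : ('I_k -> R) -> R) (Kup c0 : R) :
  (forall x, (\sum_j x j ^+ 2) `^ s <= 12 * N (lin x)) ->
  \sum_i (\sum_j u i j ^+ 2) `^ s <= d%:R ->
  0 < c0 -> (forall x, 0 <= Phi x) ->
  (forall x z, Phi z <= 2 * (Phi x + Phi (fun j => z j - x j))) ->
  (forall c x, Phi (fun j => c * x j) = pw s c * Phi x) ->
  (forall x, Phi x <= Kup * N (lin x)) -> 0 <= Kup ->
  Kup * d%:R <= c0 / 4 * G'%:R -> 4 * d%:R <= G'%:R :> R ->
  (forall g, 1 / 4 <= N (lin (gridpt g)) -> c0 <= Phi (gridpt g)) ->
  forall x, c0 / 4 * N (lin x) <= Phi x.
Proof.
move=> hx hw c00 Phi0 PhiD PhiZ PhiK Kup0 hK hG hgrid x.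
have s_gt0 : 0 < s by apply: lt_le_trans s_ge; rewrite invr_gt0.
have N0 y : 0 <= N y by apply: sumr_ge0 => i _; apply: pw_ge0.
have Gp : (0 : R) < G'%:R by rewrite ltr0n.
have NZ c z : N (lin (fun j => c * z j)) = pw s c * N (lin z).
  rewrite /N mulr_sumr; apply: eq_bigr => i _; rewrite -pwM; congr (pw s _).
  by rewrite /lin mulr_sumr; apply: eq_bigr => j _; rewrite mulrCA.
have [Ne|Nn0] := eqVneq (N (lin x)) 0; first by rewrite Ne mulr0.
have Np : 0 < N (lin x) by rewrite lt_def Nn0 N0.
suff main z : N (lin z) = 1 -> c0 / 4 <= Phi z.
  pose nu := (N (lin x))^-1 `^ (2 * s)^-1.
  have nuE : pw s nu = (N (lin x))^-1.
    rewrite /pw /nu -powR_mulrn ?powR_ge0// -!powRrM.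
    rewrite (_ : (2 * s)^-1 * (2%:R * s) = 1) ?powRr1 ?invr_ge0//.
    by rewrite mulVf// mulf_neq0// gt_eqF.
  have := main (fun j => nu * x j); rewrite NZ nuE mulVf// => /(_ erefl).
  by rewrite PhiZ nuE ler_pdivlMl// mulrC.
move=> Nz.
have zle j : `|z j| <= 12.
  rewrite leNgt; apply/negP => hz.
  have : \sum_j z j ^+ 2 <= 12 `^ s^-1.
    have := hx z; rewrite Nz mulr1 => h.
    have z0 : 0 <= \sum_j z j ^+ 2 by apply: sumr_ge0 => l _; rewrite sqr_ge0.
    have := ge0_ler_powR (_ : 0 <= s^-1) _ _ h.
    rewrite !nnegrE powR_ge0 invr_ge0 (ltW s_gt0) -powRrM divff ?gt_eqF// powRr1//.
    by apply.
  apply/negP; rewrite -ltNge; apply: (@le_lt_trans _ _ (12 ^+ 2)).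
    rewrite -powR_mulrn//; apply: ler_powR; first by rewrite ler1n.
    by rewrite -[2%:R]invrK lef_pV2 ?posrE ?invr_gt0.
  apply: (@lt_le_trans _ _ (z j ^+ 2)).
    by rewrite -(real_normK (num_real (z j))) ltrXn2r// nnegrE.
  by rewrite (bigD1 j)//= lerDl sumr_ge0// => l _; rewrite sqr_ge0.
have [g hg] := grid_approx zle.
have diff (v : 'I_k -> R) : (forall j, v j ^+ 2 <= G%:R^-1 ^+ 2) ->
    N (lin v) <= d%:R / G'%:R.
  move=> hv; apply: (@le_trans _ _ (\sum_i (\sum_j u i j ^+ 2) `^ s * (\sum_j v j ^+ 2) `^ s)).
    apply: ler_sum => i _.
    have u0 : 0 <= \sum_j u i j ^+ 2 by apply: sumr_ge0 => j _; rewrite sqr_ge0.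
    have v0 : 0 <= \sum_j v j ^+ 2 by apply: sumr_ge0 => j _; rewrite sqr_ge0.
    rewrite -powRM//; apply: ge0_ler_powR; rewrite ?nnegrE ?(ltW s_gt0) ?sqr_ge0//.
      by rewrite mulr_ge0.
    exact: cauchy_schwarz.
  rewrite -mulr_suml; apply: ler_pM => //; rewrite ?powR_ge0//.
    by apply: sumr_ge0 => i _; apply: powR_ge0.
  have vG : \sum_j v j ^+ 2 <= G'%:R^-1 ^+ 2.
    apply: le_trans (ler_sum _ (fun j _ => hv j)) _.
    rewrite sumr_const card_ord -[_ *+ k]mulr_natl /G natrM invfM exprMn mulrA.
    rewrite ler_piMl ?sqr_ge0// exprVn ler_pdivrMr ?exprn_gt0 ?ltr0n// mul1r.
    by rewrite expr2 -natrM ler_nat; apply: leq_trans k_le _; rewrite leq_pmulr.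
  apply: le_trans (ge0_ler_powR (ltW s_gt0) _ _ vG) _; rewrite ?nnegrE ?sqr_ge0//.
    by apply: sumr_ge0 => j _; rewrite sqr_ge0.
  by apply: mu_sq_le; rewrite ?invr_gt0// invf_le1// ler1n.
have dN := diff _ hg.
have dN' : N (lin (fun j => gridpt g j - z j)) <= d%:R / G'%:R.
  by apply: diff => j; rewrite -sqrrN opprB.
have dG4 : d%:R / G'%:R <= 1 / 4 :> R by rewrite ler_pdivrMr//; lra.
have NgridD : N (lin z) <= 2 * (N (lin (gridpt g)) + N (lin (fun j => z j - gridpt g j))).
  rewrite /N -big_split/= mulr_sumr; apply: ler_sum => i _.
  have -> : lin z i = lin (gridpt g) i + lin (fun j => z j - gridpt g j) i.
    by rewrite /lin -big_split/=; apply: eq_bigr => j _; ring.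
  by apply: pw_add => //; exact: ltW.
have Ng : 1 / 4 <= N (lin (gridpt g)) by move: NgridD; rewrite Nz; lra.
have c0P := hgrid g Ng.
have PD := PhiD z (gridpt g).
(* Here the upper bound controls the rounding error. Then [c0 <= 2 (Phi z + c0 / 4)], whence
   [c0 / 4 <= Phi z]. *)
have : Phi (fun j => gridpt g j - z j) <= c0 / 4.
  apply: le_trans (PhiK _) _; apply: le_trans (ler_wpM2l Kup0 dN') _.
  by rewrite mulrA ler_pdivrMr.
by lra.
Qed.

End Net.

(** * The number of rows against the size of the net *)

Section Numerics.
Variable R : realType.

(** Breaks the mutual dependence of rows and net: the grid refines linearly in [m], while the
    failure probability per coordinate gains [2^-m]. *)
Lemma exp2_dominates (C : nat) : exists m, (4 <= m)%N /\ (C * m <= 2 ^ m)%N.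
Proof.
have sq m : (4 <= m)%N -> (m * m <= 2 ^ m)%N.
  elim: m => // m IH; rewrite leq_eqVlt => /orP[/eqP<-//|]; rewrite ltnS => m4.
  by have := IH m4; rewrite expnS; nia.
exists (C + 4)%N; split; first by rewrite leq_addl.
by apply: leq_trans (sq _ (leq_addl _ _)); rewrite leq_mul// leq_addr.
Qed.

Definition lg d := (trunc_log 2 d).+1.

Lemma ltn_lg d : (d < 2 ^ lg d)%N.
Proof. exact: trunc_log_ltn. Qed.

Lemma lg_le d : (0 < d)%N -> (lg d <= d)%N.
Proof.
by move=> d0; apply: leq_trans (ltn_expl _ (ltnSn 1)) (trunc_logP (ltnSn 1) d0).
Qed.

(** Since [d >= 2], the successor in [lg] costs a factor 2, and [ln 2 >= 1/2] another. *)
Lemma lg_le_ln d : (1 < d)%N -> (lg d)%:R <= 4 * ln (d%:R : R).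
Proof.
move=> d1; have d0 : (0 < d)%N by apply: ltn_trans d1.
have ln2 : 2^-1 <= ln (2 : R).
  have h : ln (2^-1 : R) <= 2^-1 - 1.
    have {1}-> : (2^-1 : R) = 1 + (2^-1 - 1) by ring.
    by apply: le_ln1Dx; lra.
  by rewrite lnV ?posrE// in h; lra.
have t0 : (0 < trunc_log 2 d)%N by rewrite trunc_log_gt0.
have : (trunc_log 2 d)%:R * ln (2 : R) <= ln (d%:R : R).
  rewrite mulr_natl -lnXn// ler_ln ?posrE ?exprn_gt0 ?ltr0n//.
  by rewrite -natrX ler_nat trunc_logP.
have t1 : (1 : R) <= (trunc_log 2 d)%:R by rewrite ler1n.
by rewrite /lg -natr1; nra.
Qed.

(** Per coordinate there are at most [25 G = 50 C M d^4] grid values, and [(7/10)^2 <= 1/2] turns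
    the failure bound into [2^-(M lg d)]. Since [d^4 <= 16^(lg d)], the product is at most
    [800 C M / 2^M]. *)
Lemma grid_union (C M k d : nat) : (0 < C)%N -> (4 <= M)%N ->
  (800 * 1000 * C * M <= 2 ^ M)%N -> (k <= d)%N -> (0 < d)%N ->
  (24 * (d * (C * (2 * M) * d ^ 3))).+1%:R ^+ k *
    (7 / 10) ^+ (2 * M * (d * lg d)) <= 1 / 1000 :> R.
Proof.
move=> C0 M4 hM kd d0; set G := (d * _)%N.
have G0 : (0 < G)%N by rewrite /G !(muln_gt0, expn_gt0) d0 C0 /= andbT; apply: leq_trans M4.
pose x : R := 25 * G%:R * (7 / 10) ^+ (2 * M * lg d).
have e0 : (0 : R) <= (7 / 10) ^+ (2 * M * lg d) by rewrite exprn_ge0//; lra.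
have x0 : 0 <= x by rewrite !mulr_ge0.
suff x1 : x <= 1 / 1000.
  apply: (@le_trans _ _ (x ^+ d)).
    have -> : (7 / 10 : R) ^+ (2 * M * (d * lg d)) = ((7 / 10) ^+ (2 * M * lg d)) ^+ d.
      by rewrite -exprM mulnCA mulnC.
    rewrite /x [leRHS]exprMn; apply: ler_pM.
    - by rewrite exprn_ge0.
    - by rewrite exprn_ge0.
    - apply: (@le_trans _ _ ((25 * G%:R) ^+ k)).
        apply: lerXn2r; rewrite ?nnegrE ?mulr_ge0// -natrM ler_nat.
        by lia.
      apply: ler_weXn2l => //; rewrite -natrM ler1n; lia.
    - by [].
  have xl1 : x <= 1 by apply: le_trans x1 _; lra.
  by apply: le_trans (ler_wiXn2l x0 xl1 d0) _; rewrite expr1.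
have d16 : d%:R ^+ 4 <= 16 ^+ lg d :> R.
  have -> : (16 : R) = 2 ^+ 4 by ring.
  rewrite -exprM mulnC exprM; apply: lerXn2r; rewrite ?nnegrE ?exprn_ge0//.
  by rewrite -natrX ler_nat ltnW// ltn_lg.
have half : (7 / 10) ^+ (2 * M * lg d) <= (2^-1 ^+ M) ^+ lg d :> R.
  rewrite -mulnA exprM exprM -[X in _ <= X]exprM [X in _ <= X]exprM.
  apply: lerXn2r; rewrite ?nnegrE ?exprn_ge0 ?invr_ge0//; first by lra.
  by apply: lerXn2r; rewrite ?nnegrE ?exprn_ge0 ?invr_ge0//; lra.
have CM0 : (0 : R) <= C%:R * M%:R by rewrite mulr_ge0.
have xE : x = 50 * (C%:R * M%:R) * (d%:R ^+ 4 * (7 / 10) ^+ (2 * M * lg d)).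
  by rewrite /x /G !(natrX, natrM); ring.
have h2 : d%:R ^+ 4 * (7 / 10) ^+ (2 * M * lg d) <= 16 * 2^-1 ^+ M :> R.
  apply: (@le_trans _ _ ((16 * 2^-1 ^+ M) ^+ lg d)).
    by rewrite [leRHS]exprMn; apply: ler_pM => //; rewrite exprn_ge0.
  have y0 : 0 <= 16 * 2^-1 ^+ M :> R by rewrite mulr_ge0 ?exprn_ge0 ?invr_ge0.
  rewrite /lg exprS ler_piMr// exprn_ile1//.
  have -> : (16 : R) = 2 ^+ 4 by ring.
  rewrite exprVn ler_pdivrMr ?exprn_gt0// mul1r.
  by apply: ler_weXn2l => //; rewrite ler1n.
have pM : (0 : R) < 2 ^+ M by rewrite exprn_gt0.
have hM' : 800 * 1000 * (C%:R * M%:R) <= 2 ^+ M :> R.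
  by rewrite mulrA -!natrM -natrX ler_nat.
rewrite xE; apply: le_trans (ler_wpM2l _ h2) _; first by rewrite mulr_ge0.
rewrite exprVn !mulrA ler_pdivrMr//.
by lra.
Qed.

End Numerics.

(** * Flat and spiky vectors *)

Section FlatOrSpiky.
Variables (R : realType) (n : nat) (s tau : R).
Hypotheses (s_gt0 : 0 < s) (s_lt1 : s < 1) (tau_gt0 : 0 < tau) (tau_le : tau <= 1 / 16).

(** Write [m = |y_i|^p]. Coordinates with [m < tau / 2^n], out of reach of the dilations, carry at
    most [n tau / 2^n <= tau] in all; this justifies the cut-off at level [n]. Where [m > tau], one
    has [y_i^2 = m^(1/s) >= m tau^(1/s - 1)]. *)
Lemma flat_or_spiky (y : 'I_n -> R) : 1 / 4 <= \sum_i pw s (y i) ->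
  1 / 16 <= \sum_(i | (pw s (y i) <= tau) && (tau <= pw s (y i) * 2 ^+ n)) pw s (y i) \/
  tau `^ (s^-1 - 1) / 8 <= \sum_i y i ^+ 2.
Proof.
move=> hN.
have [h|h] := leP (1 / 8) (\sum_(i | ~~ (pw s (y i) <= tau)) pw s (y i)).
  right; have t0 : 0 <= tau `^ (s^-1 - 1) by apply: powR_ge0.
  apply: (@le_trans _ _ (tau `^ (s^-1 - 1) * \sum_(i | ~~ (pw s (y i) <= tau)) pw s (y i))).
    by have := ler_wpM2l t0 h; lra.
  rewrite mulr_sumr big_mkcond/=; apply: ler_sum => i _.
  case: ifPn => [|_]; last by rewrite sqr_ge0.
  rewrite -ltNge => hi; have a0 := pw_ge0 s (y i).
  have -> : y i ^+ 2 = pw s (y i) `^ s^-1.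
    by rewrite /pw -powRrM divff ?gt_eqF// powRr1// sqr_ge0.
  rewrite -(mulr_powRB1 a0 (_ : 0 < s^-1)) ?invr_gt0// mulrC ler_wpM2l//.
  apply: ge0_ler_powR; rewrite ?nnegrE ?(ltW tau_gt0)//; last exact: ltW.
  by rewrite subr_ge0 invf_ge1// ltW.
left.
move: hN; rewrite (bigID (fun i => pw s (y i) <= tau))/= => hN.
rewrite (bigID (fun i => tau <= pw s (y i) * 2 ^+ n)) /= in hN.
have : \sum_(i | (pw s (y i) <= tau) && ~~ (tau <= pw s (y i) * 2 ^+ n)) pw s (y i) <= 1 / 16.
  apply: le_trans tau_le.
  have p2 : (0 : R) < 2 ^+ n by rewrite exprn_gt0.
  apply: (@le_trans _ _ (\sum_(i < n) tau / 2 ^+ n)).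
    rewrite big_mkcond/=; apply: ler_sum => i _.
    case: ifPn => [/andP[_]|_]; last by rewrite divr_ge0// ltW.
    by rewrite -ltNge -ltr_pdivlMr// => /ltW.
  rewrite sumr_const card_ord -[leLHS]mulr_natl mulrCA ler_piMr ?(ltW tau_gt0)//.
  by rewrite ler_pdivrMr// mul1r -natrX ler_nat ltnW// ltn_expl.
by lra.
Qed.

End FlatOrSpiky.

(** * Combining the blocks *)

Section DeterministicCore.
Variables (R : realType) (n k d r1 r2 G' : nat) (s : R).
Hypotheses (s_ge : 2^-1 <= s) (s_lt1 : s < 1) (k_le : (k <= d)%N).
Hypotheses (d_gt0 : (0 < d)%N) (G'_gt0 : (0 < G')%N) (r2_gt0 : (0 < r2)%N).
Variables (h : {ffun 'I_n -> 'I_r1}) (e : {ffun 'I_n -> bool}).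
Variable w : {ffun 'I_n -> 'I_r2 * 'I_n.+1}.

Definition boost (r : nat) : R := r%:R `^ ((1 - s) * (2 * s)^-1).

Definition sketch_mass (y : 'I_n -> R) : R :=
  \sum_b pw s (boost r2 * bucket e h y b) + \sum_b pw s (bval s y e w b).

Let s_gt0 : 0 < s. Proof. by apply: lt_le_trans s_ge; rewrite invr_gt0. Qed.

Lemma pw_boost : pw s (boost r2) = r2%:R `^ (1 - s).
Proof.
rewrite /pw /boost -powR_mulrn ?powR_ge0// -!powRrM; congr (_ `^ _).
by field; rewrite gt_eqF.
Qed.

Lemma sketch_mass_ge0 y : 0 <= sketch_mass y.
Proof. by apply: addr_ge0; apply: sumr_ge0 => b _; apply: pw_ge0. Qed.

Lemma sketch_massD y z : sketch_mass (fun i => y i + z i) <=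
  2 * (sketch_mass y + sketch_mass z).
Proof.
rewrite /sketch_mass addrACA mulrDr -!big_split/= !mulr_sumr.
apply: lerD; apply: ler_sum => b _.
  have -> : bucket e h (fun i => y i + z i) b = bucket e h y b + bucket e h z b.
    by rewrite -big_split/=; apply: eq_bigr => i _; rewrite mulrDr.
  by rewrite mulrDr; apply: pw_add => //; exact: ltW.
have -> : bval s (fun i => y i + z i) e w b = bval s y e w b + bval s z e w b.
  by rewrite -big_split/=; apply: eq_bigr => i _; rewrite !mulrDr.
by apply: pw_add => //; exact: ltW.
Qed.

Lemma sketch_massZ c y : sketch_mass (fun i => c * y i) = pw s c * sketch_mass y.
Proof.
rewrite /sketch_mass mulrDr !mulr_sumr; congr (_ + _); apply: eq_bigr => b _.
  rewrite -pwM mulrCA; congr (pw s (_ * _)).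
  by rewrite mulr_sumr; apply: eq_bigr => i _; rewrite mulrCA.
rewrite -pwM; congr (pw s _).
by rewrite /bval mulr_sumr; apply: eq_bigr => i _; rewrite !(mulrCA c).
Qed.

Variable u : 'I_n -> 'I_k -> R.
Let lin (x : 'I_k -> R) i := \sum_a u i a * x a.
Let N (y : 'I_n -> R) := \sum_i pw s (y i).

Variables (c1 c2 : R).
Hypotheses (c1_ge0 : 0 <= c1) (c2_ge0 : 0 <= c2).
Hypothesis lewis : forall x, (\sum_j x j ^+ 2) `^ s <= 12 * N (lin x).
Hypothesis mass : \sum_i (\sum_j u i j ^+ 2) `^ s <= d%:R.
Hypothesis l2_lower : forall x,
  2^-1 * \sum_i lin x i ^+ 2 <= \sum_b bucket e h (lin x) b ^+ 2.
Hypothesis upper1 : forall x, \sum_b pw s (bucket e h (lin x) b) <= c1 * N (lin x).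
Hypothesis upper2 : forall x, \sum_b pw s (bval s (lin x) e w b) <= c2 * (\sum_j x j ^+ 2) `^ s.

Let Kup := r2%:R `^ (1 - s) * c1 + 12 * c2.

Lemma core_upper x : sketch_mass (lin x) <= Kup * N (lin x).
Proof.
rewrite mulrDl; apply: lerD.
  under eq_bigr do rewrite pwM pw_boost.
  by rewrite -mulr_sumr -mulrA ler_wpM2l ?powR_ge0.
apply: le_trans (upper2 x) _.
by rewrite [12 * _]mulrC -mulrA ler_wpM2l.
Qed.

Let tau : R := (128 * r2%:R)^-1.

(** [tau] makes [8 tau r2 = 1/16], the flat mass available. Both cases end at [1/2048]: the flat one
    as [(1/128) / 16], the spiky one as [(r2 tau)^(1 - s) 16^-s], where the scaling of the first
    block cancels the dependence on [r2]. *)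
Lemma core_grid y : 1 / 4 <= N y ->
  (2^-1 * \sum_i y i ^+ 2 <= \sum_b bucket e h y b ^+ 2) ->
  (8 * tau * r2%:R <= \sum_(i | (pw s (y i) <= tau) && (tau <= pw s (y i) * 2 ^+ n)) pw s (y i) ->
    r2%:R * tau < 16 * \sum_b pw s (bval s y e w b)) ->
  1 / 2048 <= sketch_mass y.
Proof.
move=> hN hl2 hball.
have rp : (0 : R) < r2%:R by rewrite ltr0n.
have r1' : (1 : R) <= r2%:R by rewrite ler1n.
have tp : 0 < tau by rewrite invr_gt0 mulr_gt0.
have tr : tau * r2%:R = 1 / 128 by rewrite /tau invfM -mulrA mulVf ?gt_eqF// mulr1 div1r.
have tle : tau <= 1 / 16.
  have : tau <= tau * r2%:R by rewrite ler_peMr// ltW.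
  by rewrite tr => /le_trans; apply; lra.
have S1 : 0 <= \sum_b pw s (boost r2 * bucket e h y b) by apply: sumr_ge0 => b _; apply: pw_ge0.
have S2 : 0 <= \sum_b pw s (bval s y e w b) by apply: sumr_ge0 => b _; apply: pw_ge0.
have [flat|spiky] := flat_or_spiky s_gt0 s_lt1 tp tle hN.
  have := hball; rewrite -mulrA tr.
  have -> : 8 * (1 / 128) = 1 / 16 :> R by lra.
  rewrite [r2%:R * _]mulrC tr => /(_ flat) hh.
  apply: (@le_trans _ _ (\sum_b pw s (bval s y e w b))); last by rewrite lerDr.
  by move: hh; lra.
apply: (@le_trans _ _ (\sum_b pw s (boost r2 * bucket e h y b))); last by rewrite lerDl.
under eq_bigr do rewrite pwM pw_boost.
rewrite -mulr_sumr.
have p16 : (0 : R) <= 1 / 16 by lra.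
apply: (@le_trans _ _ (r2%:R `^ (1 - s) * (tau `^ (s^-1 - 1) * (1 / 16)) `^ s)).
  rewrite (powRM s (powR_ge0 _ _) p16) -powRrM mulrA.
  have -> : (s^-1 - 1) * s = 1 - s by rewrite mulrBl mulVf ?gt_eqF// mul1r.
  rewrite -powRM ?(ltW rp) ?(ltW tp)// [r2%:R * _]mulrC tr.
  have -> : 1 / 2048 = 1 / 128 * (1 / 16) :> R by lra.
  apply: ler_pM => //; try (by lra).
    by apply: ger1_powR; [lra|rewrite gerBl ltW].
  by apply: ger1_powR; [lra|exact: ltW].
rewrite ler_wpM2l ?powR_ge0//.
apply: (@le_trans _ _ ((\sum_b bucket e h y b ^+ 2) `^ s)); last first.
  by apply: powR_sum_le => //; [exact: ltW|move=> b _; rewrite sqr_ge0].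
apply: ge0_ler_powR; rewrite ?nnegrE ?(ltW s_gt0)//.
- by rewrite mulr_ge0 ?powR_ge0.
- by apply: sumr_ge0 => b _; rewrite sqr_ge0.
by move: spiky hl2; lra.
Qed.

Lemma core_lower : (forall g, 8 * tau * r2%:R <= \sum_(i | (pw s (lin (gridpt R (d:=d) (G':=G') g) i) <= tau) &&
       (tau <= pw s (lin (gridpt R g) i) * 2 ^+ n)) pw s (lin (gridpt R g) i) ->
    r2%:R * tau < 16 * \sum_b pw s (bval s (lin (gridpt R g)) e w b)) ->
  Kup * d%:R <= 1 / 8192 * G'%:R -> 4 * d%:R <= G'%:R :> R ->
  forall x, 1 / 8192 * N (lin x) <= sketch_mass (lin x).
Proof.
move=> hball hK hG x.
have c0 : (0 : R) < 1 / 2048 by lra.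
have e4 : 1 / 2048 / 4 = 1 / 8192 :> R by lra.
have := @net_lower R n k d G' s s_ge s_lt1 k_le d_gt0 G'_gt0 u
  (fun x => sketch_mass (lin x)) Kup (1 / 2048) lewis mass.
rewrite e4; apply => //.
- by move=> z; apply: sketch_mass_ge0.
- move=> y z.
  have -> : lin z = (fun i => lin y i + lin (fun j => z j - y j) i).
    by apply/funext => i; rewrite /lin -big_split/=; apply: eq_bigr => j _; ring.
  exact: sketch_massD.
- move=> c y; rewrite -sketch_massZ; congr sketch_mass; apply/funext => i.
  by rewrite /lin mulr_sumr; apply: eq_bigr => j _; rewrite mulrCA.
- exact: core_upper.
- by rewrite addr_ge0 ?mulr_ge0 ?powR_ge0.
by move=> g hg; exact: (core_grid hg (l2_lower _) (hball g)).
Qed.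

End DeterministicCore.

(** * The embedding with constant probability *)

Section ObliviousEmbedding.
Variable R : realType.

Lemma Pr_fprod_snd_fst (T1 T2 T3 : finType) (m1 : fdist R T1) (m2 : fdist R T2)
    (m3 : fdist R T3) (A : T2 -> T3 -> Prop) :
  Pr (fprod (fprod m1 m2) m3) (fun w => A w.1.2 w.2) =
  Pr (fprod m2 m3) (fun w => A w.1 w.2).
Proof.
rewrite /Pr (Ex_fprod _ _ (fun (t1 : T1 * T2) t3 => `[< A t1.2 t3 >]%:R)).
rewrite (Ex_fprod _ _ (fun (_ : T1) t2 => Ex m3 (fun t3 => `[< A t2 t3 >]%:R))) Ex_cst.
by rewrite (Ex_fprod _ _ (fun t2 t3 => `[< A t2 t3 >]%:R)).
Qed.

(** The left-hand side is the total upper bound of both blocks. The key is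
    [(M D L)^(1 - s) D^s <= M D L]; the [11 L] dominates [L + 10], the exponent with
    [1000 d <= 2^(L + 10)]. *)
Lemma dilation_bound (s K0 csm D L M t : R) : 0 < s -> s < 1 -> 0 <= K0 -> 0 < csm ->
  1 <= D -> 1 <= L -> 1 <= M -> t <= 11 * L ->
  (M * (D * L)) `^ (1 - s) * (2 * K0 * D `^ s) +
    12 * (2 * ((M * (D * L)) `^ (1 - s) * (1000 * csm * D) `^ s + 1000 * t * D)) <=
  (2 * K0 + 24 * ((1000 * csm) `^ s + 11 * 1000)) * (M * (D * L)).
Proof.
move=> s0 s1 K00 c0 D1 L1 M1 tL.
have D0 : 0 < D by lra.
have ML1 : 1 <= M * L by nra.
have ML0 : 0 <= M * L by lra.
have mix : (M * (D * L)) `^ (1 - s) * D `^ s <= M * (D * L).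
  have -> : M * (D * L) = M * L * D by ring.
  rewrite powRM ?(ltW D0)// -mulrA -powRD; last by rewrite (gt_eqF D0) implybT.
  rewrite subrK powRr1 ?(ltW D0)// ler_wpM2r ?(ltW D0)//.
  by apply: ler1_powR => //; lra.
have csm0 : 0 <= 1000 * csm by lra.
rewrite (powRM s csm0 (ltW D0)).
set P := (M * (D * L)) `^ (1 - s) in mix *.
set Q := (1000 * csm) `^ s; have Q0 : 0 <= Q by apply: powR_ge0.
have h1 : 2 * K0 * (P * D `^ s) <= 2 * K0 * (M * (D * L)) by rewrite ler_wpM2l// mulr_ge0.
have h2 : 24 * Q * (P * D `^ s) <= 24 * Q * (M * (D * L)) by rewrite ler_wpM2l// mulr_ge0.
have h3 : t * D <= 11 * (M * (D * L)).
  apply: (@le_trans _ _ (11 * L * D)); first by rewrite ler_wpM2r// ltW.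
  have -> : 11 * (M * (D * L)) = M * (11 * L * D) by ring.
  by rewrite ler_peMl// mulr_ge0 ?(ltW D0)//; lra.
have -> : P * (2 * K0 * D `^ s) + 12 * (2 * (P * (Q * D `^ s) + 1000 * t * D)) =
   2 * K0 * (P * D `^ s) + 24 * Q * (P * D `^ s) + 24 * 1000 * (t * D) by ring.
by lra.
Qed.

Theorem oblivious_embedding (s : R) : 2^-1 <= s -> s < 1 ->
  exists (c C : R) (M : nat), [/\ 0 < c, 0 < C, (0 < M)%N &
  forall d n (d_gt0 : (0 < d)%N) (r2_gt0 : (0 < #|'I_(M * (d * lg d))|)%N)
    (A : 'I_n -> 'I_d -> R), (1 < d)%N ->
  Pr (fprod (fprod (hashes R n (block1_rows_gt0 d_gt0)) (signs R n)) (spread R n n r2_gt0))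
    (fun w => ~ forall x : 'I_d -> R, let y i := \sum_l A i l * x l in
       c * (\sum_i pw s (y i)) <= sketch_mass s w.1.1 w.1.2 w.2 y /\
       sketch_mass s w.1.1 w.1.2 w.2 y <= C * (d%:R * ln d%:R) * (\sum_i pw s (y i)))
  <= 1 / 100].
Proof.
move=> s_ge s_lt1.
have s_gt0 : 0 < s by apply: lt_le_trans s_ge; rewrite invr_gt0.
have e7 : 7 / 1000 <= 1 / 100 :> R by lra.
pose K0 : R := 50 + 156 * 1200 ^+ 2.
pose C5 : R := 2 * K0 + 24 * ((1000 * csmall s) `^ s + 11 * 1000).
have K00 : 0 <= K0 by rewrite addr_ge0 ?mulr_ge0 ?sqr_ge0.
have csm0 := csmall_gt0 s_gt0 s_lt1.
have C50 : 0 < C5.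
  by rewrite ltr_wpDl ?mulr_ge0// mulr_gt0// ltr_wpDl ?powR_ge0// mulr_gt0.
pose C6 := (Num.truncn (8192 * C5)).+1.
have C6P : 8192 * C5 <= C6%:R by rewrite ltW// truncnS_gt.
have [M' [M4 hM']] := exp2_dominates (800 * 1000 * C6).
have [M [ME M0]] : exists M, M = (2 * M')%N /\ (0 < M)%N.
  by exists (2 * M')%N; rewrite muln_gt0; split=> //; apply: leq_trans M4.
exists (1 / 8192), (C5 * M%:R * 4), M.
have Mp : (0 : R) < M%:R by rewrite ltr0n.
split => //; first by rewrite mulr_gt0 ?invr_gt0 ?ltr0n.
  by rewrite !mulr_gt0.
move=> d n d_gt0 r2_gt0 A d1.
pose L := lg d; pose r2 := (M * (d * L))%N.
(* By [L <= d] the upper bound times [d] is at most [C5 M d^3], hence at most [G' / 8192]. *)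
pose G' := (C6 * M * d ^ 3)%N.
have G'0 : (0 < G')%N by rewrite /G' !(muln_gt0, expn_gt0) d_gt0 M0.
have r2p : (0 < r2)%N by move: (r2_gt0); rewrite card_ord.
have D1 : (1 : R) <= d%:R by rewrite ler1n.
have L1 : (1 : R) <= L%:R by rewrite ler1n.
have M1 : (1 : R) <= M%:R by rewrite ler1n.
have LD : (L%:R : R) <= d%:R by rewrite ler_nat lg_le.
have r2E : r2%:R = M%:R * (d%:R * L%:R) :> R by rewrite /r2 !natrM.
have [k [u [kd mass yz lewis]]] := exists_lewis_basis A s_ge (ltW s_lt1).
have half1 : 2^-1 <= 1 :> R by rewrite invf_le1 ?ler1n.
(* A basis for exponent 2 spanning the columns of [u]: the l2 embedding compares [|x|] with the l2
   norm, not with the l_p norm that [u] is adapted to. *)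
have [k2 [u2 [k2k mass2 yz2 lewis2]]] := exists_lewis_basis u half1 (lexx _).
have kdR : k%:R <= d%:R :> R by rewrite ler_nat.
have k2dR : k2%:R <= d%:R :> R by rewrite ler_nat (leq_trans k2k).
pose tau : R := (128 * r2%:R)^-1.
have tau0 : 0 < tau by rewrite invr_gt0 mulr_gt0// ltr0n.
pose Om := fprod (fprod (hashes R n (block1_rows_gt0 d_gt0)) (signs R n)) (spread R n n r2_gt0).
pose lin (x : 'I_k -> R) i := \sum_a u i a * x a.
have E1 := @block1_lower R n k2 d d_gt0 u2.
have {}E1 : Pr Om (fun w => ~ forall x : 'I_k -> R,
    2^-1 * \sum_i lin x i ^+ 2 <= \sum_b bucket w.1.2 w.1.1 (lin x) b ^+ 2) <= 1 / 1000.
  rewrite (Pr_fprodl _ _ (fun v : {ffun 'I_n -> 'I_((1200 * d) ^ 2)} * {ffun 'I_n -> bool} =>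
    ~ forall x : 'I_k -> R,
    2^-1 * \sum_i lin x i ^+ 2 <= \sum_b bucket v.2 v.1 (lin x) b ^+ 2)).
  apply: le_trans _ (E1 _ _); last 2 first.
  - apply: le_trans k2dR; apply: le_trans mass2.
    by apply: ler_sum => i _; rewrite powRr1// sumr_ge0// => j _; rewrite sqr_ge0.
  - move=> x; have := lewis2 x; rewrite powRr1; last by rewrite sumr_ge0// => j _; rewrite sqr_ge0.
    by under [X in _ <= _ * X -> _]eq_bigr do rewrite /pw powRr1 ?sqr_ge0//.
  apply: Pr_le => v bad good; apply: bad => x.
  have [z hz] := yz2 x; have -> : lin x = (fun i => \sum_a u2 i a * z a) by apply/funext.
  exact: good.
have E2 := @block1_upper R n k d s s_ge s_lt1 d_gt0 u (le_trans mass kdR) lewis.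
have {}E2 : Pr Om (fun w => ~ forall x : 'I_k -> R,
    \sum_b pw s (bucket w.1.2 w.1.1 (lin x) b) <= 2 * K0 * d%:R `^ s * \sum_i pw s (lin x i)) <= 2 / 1000.
  by rewrite (Pr_fprodl _ _ (fun v : {ffun 'I_n -> 'I_((1200 * d) ^ 2)} * {ffun 'I_n -> bool} =>
    ~ forall x : 'I_k -> R,
    \sum_b pw s (bucket v.2 v.1 (lin x) b) <= 2 * K0 * d%:R `^ s * \sum_i pw s (lin x i))).
have ht : 1000 * d%:R <= 2 ^+ (L + 10) :> R.
  rewrite exprD mulrC; apply: ler_pM => //.
    by rewrite -natrX ler_nat ltnW// ltn_lg.
  by rewrite -natrX ler_nat.
pose c2 : R := 2 * (r2%:R `^ (1 - s) * (1000 * csmall s * d%:R) `^ s + 1000 * (L + 10)%:R * d%:R).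
have E3 := dilated_upper n r2_gt0 s_gt0 s_lt1 D1 (le_trans mass kdR) ht.
have {}E3 : Pr Om (fun w => ~ forall x : 'I_k -> R,
    \sum_b pw s (bval s (lin x) w.1.2 w.2 b) <= c2 * (\sum_j x j ^+ 2) `^ s) <= 3 / 1000.
  by rewrite (Pr_fprod_snd_fst _ _ _ (fun e w => ~ forall x : 'I_k -> R,
    \sum_b pw s (bval s (lin x) e w b) <= c2 * (\sum_j x j ^+ 2) `^ s)).
pose flat (y : 'I_n -> R) := 8 * tau * r2%:R <= \sum_(i | (pw s (y i) <= tau) && (tau <= pw s (y i) * 2 ^+ n)) pw s (y i).
pose bad4 (e : {ffun 'I_n -> bool}) (w : {ffun 'I_n -> 'I_(M * (d * lg d)) * 'I_n.+1}) := exists g : {ffun 'I_k -> 'I_(24 * (d * G')).+1},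
  flat (lin (gridpt R g)) /\ 16 * \sum_b pw s (bval s (lin (gridpt R g)) e w b) <= r2%:R * tau.
have E4 : Pr Om (fun w => bad4 w.1.2 w.2) <= 1 / 1000.
  rewrite Pr_fprod_snd_fst; apply: le_trans (Pr_exists _ _) _.
  apply: le_trans _ (grid_union R _ M4 hM' kd d_gt0); last by [].
  rewrite -ME -/G' -/L.
  apply: (@le_trans _ _ (\sum_(g : {ffun 'I_k -> 'I_(24 * (d * G')).+1}) (7 / 10) ^+ r2)).
    apply: ler_sum => g _.
    have [fl|nfl] := pselect (flat (lin (gridpt R g))).
      apply: le_trans _ (small_ball r2_gt0 s_gt0 tau0 fl).
      by apply: Pr_le => v [].
    apply: (@le_trans _ _ 0); last by rewrite exprn_ge0// divr_ge0.
    by rewrite /Pr /Ex big1// => v _; rewrite asboolF ?mulr0// => -[].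
  by rewrite sumr_const card_ffun !card_ord -[leLHS]mulr_natl natrX.
have : Pr Om (fun w => (~ forall x : 'I_k -> R,
    2^-1 * \sum_i lin x i ^+ 2 <= \sum_b bucket w.1.2 w.1.1 (lin x) b ^+ 2) \/
   ((~ forall x : 'I_k -> R,
    \sum_b pw s (bucket w.1.2 w.1.1 (lin x) b) <= 2 * K0 * d%:R `^ s * \sum_i pw s (lin x i)) \/
   ((~ forall x : 'I_k -> R,
    \sum_b pw s (bval s (lin x) w.1.2 w.2 b) <= c2 * (\sum_j x j ^+ 2) `^ s) \/
    bad4 w.1.2 w.2))) <= 7 / 1000.
  have -> : 7 / 1000 = 1 / 1000 + (2 / 1000 + (3 / 1000 + 1 / 1000)) :> R by field.
  apply: le_trans (Pr_or _ _ _) (lerD E1 _).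
  apply: le_trans (Pr_or _ _ _) (lerD E2 _).
  exact: le_trans (Pr_or _ _ _) (lerD E3 E4).
move=> /le_trans/(_ e7); apply: le_trans; apply: Pr_le => w bad.
apply: contrapT => /not_orP[/contrapT good1 /not_orP[/contrapT good2 /not_orP[/contrapT good3 good4]]].
apply: bad => x y.
have [z hz] := yz x; have -> : y = lin z by apply/funext.
have c10 : 0 <= 2 * K0 * d%:R `^ s by rewrite !mulr_ge0 ?powR_ge0.
have t11 : (L + 10)%:R <= 11 * L%:R :> R.
  by rewrite -natrM ler_nat mulSn leq_add2l leq_pmulr.
have c20 : 0 <= c2.
  by rewrite mulr_ge0// addr_ge0// ?mulr_ge0 ?powR_ge0.
have Kle := dilation_bound s_gt0 s_lt1 K00 csm0 D1 L1 M1 t11.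
rewrite -r2E -/c2 -/C5 in Kle.
have Nz0 : 0 <= \sum_i pw s (lin z i) by apply: sumr_ge0 => i _; apply: pw_ge0.
split; last first.
  apply: le_trans (core_upper s_ge c20 lewis good2 good3 z) _.
  rewrite ler_wpM2r//; apply: le_trans Kle _.
  rewrite r2E -!mulrA ler_wpM2l ?(ltW C50)// ler_wpM2l ?(ltW Mp)// mulrCA.
  by rewrite ler_wpM2l// lg_le_ln.
apply: (core_lower (G' := G') s_ge s_lt1 kd d_gt0 G'0 r2p c10 c20 lewis (le_trans mass kdR) good1 good2 good3).
- move=> g fl; rewrite ltNge; apply/negP => hb; apply: good4.
  by exists g.
- apply: le_trans (ler_wpM2r _ Kle) _; first by rewrite ler0n.
  rewrite /G' 2!natrM natrX r2E.
  have hC : C5 <= 1 / 8192 * C6%:R by move: C6P; rewrite mul1r ler_pdivlMl.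
  have -> : 1 / 8192 * (C6%:R * M%:R * d%:R ^+ 3) = 1 / 8192 * C6%:R * (M%:R * (d%:R * d%:R)) * d%:R :> R by ring.
  rewrite ler_wpM2r// ; apply: ler_pM => //; first exact: ltW.
    by rewrite !mulr_ge0.
  by rewrite ler_wpM2l// ler_wpM2l.
rewrite -natrM ler_nat /G'.
have h8 : (4 <= C6 * M)%N.
  by apply: leq_trans (leq_pmull _ _) => //; rewrite ME; apply: leq_trans M4 _; rewrite leq_pmull.
by rewrite leq_mul// -[X in (X <= _)%N]expn1 leq_pexp2l.
Qed.

End ObliviousEmbedding.

(** * Matrices and probability spaces *)

Import Rstruct Rstruct_topology.

Section FiniteProbSpace.
Variables (T : finType) (m : fdist R T).

(** Each point of the union lies in exactly one [F k]; beyond the largest such index over the finite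
    carrier the partial sums equal the limit. *)
Lemma Pr_sigma_additive (F : nat -> T -> Prop) :
  (forall k l t, k <> l -> F k t -> F l t -> False) ->
  infinite_sum (fun k => Pr m (F k)) (Pr m (fun t => exists k, F k t)).
Proof.
move=> disj.
have [idx idxP] : exists idx : T -> nat, forall t, (exists k, F k t) -> F (idx t) t.
  have ex t : exists i, (exists k, F k t) -> F i t.
    have [[k Fk]|nF] := pselect (exists k, F k t); first by exists k.
    by exists 0%N.
  by have [idx idxP] := boolp.choice ex; exists idx.
move=> eps eps0; exists (\max_t idx t)%N => n /ssrnat.leP Nn.
rewrite sum_f_R0E -Ex_sum.
suff -> : Ex m (fun t => \sum_(0 <= k < n.+1) `[< F k t >]%:R) =
    Pr m (fun t => exists k, F k t).
  by rewrite /R_dist Rminus_diag Rabs_R0.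
apply: eq_Ex => t; case: (asboolP (exists k, F k t)) => [Ft|nF]; last first.
  by rewrite big1// => k _; rewrite asboolF// => Fk; apply: nF; exists k.
have it : (idx t < n.+1)%N by rewrite ltnS; apply: leq_trans Nn; apply: leq_bigmax.
rewrite big_mkord (bigD1 (Ordinal it))//= (asboolT (idxP t Ft)) big1 ?addr0// => k kt.
rewrite asboolF// => Fk; apply: (disj k (idx t) t) => //; last exact: idxP.
by move=> e; move: kt; rewrite -val_eqE/= e eqxx.
Qed.

Definition finite_prob_space : prob_space.
Proof.
refine (@Build_prob_space T (fun _ => True) (fun E => Pr m E) _ _ _ _ _ _ _) => //.
- move=> E F EF _; split=> //; congr Pr; by apply/funext => t; apply/propext.
- by move=> E _; apply/RleP/Pr_ge0.
- exact: Pr_true.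
- by move=> F _ disj; exact: Pr_sigma_additive.
Defined.

End FiniteProbSpace.

Lemma rsumE k (f : nat -> R) : rsum k f = \sum_(i < k) f i.
Proof. by elim: k => [|k IH]; rewrite ?big_ord0// big_ord_recr/= IH. Qed.

Lemma RpowerE (a x : R) : 0 < a -> Rpower a x = a `^ x.
Proof. by move=> a0; rewrite /Rpower /powR gt_eqF// RexpE RlnE. Qed.

Lemma powabsE (t p : R) : 0 < p -> powabs t p = pw (p / 2) t.
Proof.
move=> p0; rewrite /powabs; case: RIneq.Req_EM_T => [->|/eqP t0].
  by rewrite pw0// divr_gt0.
rewrite RabsE RpowerE ?normr_gt0// /pw -[in RHS]real_normK ?num_real//.
rewrite -powR_mulrn// -powRrM; congr (_ `^ _).
by rewrite mulrC divfK ?pnatr_eq0.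
Qed.

Lemma pnormE (p : R) k (y : nat -> R) : 0 < p ->
  pnorm p k y = (\sum_(i < k) pw (p / 2) (y i)) `^ p^-1.
Proof.
move=> p0; rewrite /pnorm rsumE.
have -> : \sum_(i < k) powabs (y i) p = \sum_(i < k) pw (p / 2) (y i).
  by apply: eq_bigr => i _; rewrite powabsE.
case: RIneq.Req_EM_T => [->|/eqP s0]; first by rewrite powR0// invr_neq0// gt_eqF.
rewrite RpowerE; last first.
  by rewrite lt_def s0/= sumr_ge0// => i _; rewrite pw_ge0.
by rewrite RdivE R1E div1r.
Qed.

Section SketchMatrix.
Variables (n r1 r2 : nat) (s : R).
Variables (h : {ffun 'I_n -> 'I_r1}) (e : {ffun 'I_n -> bool}).
Variable w : {ffun 'I_n -> 'I_r2 * 'I_n.+1}.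

(** Row [r1 + b] is bucket [b] of the dilated block. Both blocks share their signs, as their failure
    events meet only in a union bound. *)
Definition sketch_entry (i : nat) (j : 'I_n) : R :=
  if (i < r1)%N then (h j == i :> nat)%:R * (boost s r2 * sg R e j)
  else (rhash w j + r1 == i)%N%:R * (sg R e j * dil s (rlev w j)).

Definition sketch_matrix (i j : nat) : R :=
  if insub j is Some j' then sketch_entry i j' else 0.

Lemma sketch_matrix_sparse : col_sparse2 (r1 + r2) n sketch_matrix.
Proof.
move=> j /ssrnat.ltP jn i1 i2 i3 _ _ _ n12 n13 n23.
pose j' := Ordinal jn.
have z (i : nat) : i <> h j' -> i <> (rhash w j' + r1)%N -> sketch_matrix i j = 0.
  move=> ih ir; rewrite /sketch_matrix insubT /= /sketch_entry.
  by case: ifP => _; case: eqP => [E|_]; rewrite ?mul0r//; [case: ih|case: ir].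
have [e1|/eqP a1] := eqVneq i1 (h j' : nat); have [e2|/eqP a2] := eqVneq i2 (h j' : nat).
- by case: n12; rewrite e1 e2.
- have [b2|/eqP b2] := eqVneq i2 (rhash w j' + r1)%N; last by right; left; apply: z.
  right; right; apply: z => [e3|b3]; first by case: n13; rewrite e1 e3.
  by case: n23; rewrite b2 b3.
- have [b1|/eqP b1] := eqVneq i1 (rhash w j' + r1)%N; last by left; apply: z.
  right; right; apply: z => [e3|b3]; first by case: n23; rewrite e2 e3.
  by case: n13; rewrite b1 b3.
have [b1|/eqP b1] := eqVneq i1 (rhash w j' + r1)%N; last by left; apply: z.
by right; left; apply: z => // b2; case: n12; rewrite b1 b2.
Qed.

Lemma sketch_matrix_mass (y : nat -> R) :
  \sum_(i < r1 + r2) pw s (mulmv n sketch_matrix y i) =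
  sketch_mass s h e w (fun j : 'I_n => y j).
Proof.
have mE i : mulmv n sketch_matrix y i = \sum_(j < n) sketch_entry i j * y j.
  rewrite /mulmv rsumE; apply: eq_bigr => j _.
  by rewrite RmultE /sketch_matrix valK.
rewrite big_split_ord; congr (_ + _); apply: eq_bigr => b _; rewrite mE; congr (pw s _).
  rewrite /bucket mulr_sumr [RHS]big_mkcond/=; apply: eq_bigr => j _.
  rewrite /sketch_entry /= ltn_ord val_eqE.
  by case: (h j == b); rewrite ?mul1r ?mul0r ?mulrA.
rewrite /bval /bucket [RHS]big_mkcond/=; apply: eq_bigr => j _.
rewrite /sketch_entry /= ltnNge leq_addr /= addnC eqn_add2l val_eqE.
by case: (rhash w j == b); rewrite ?mul1r ?mul0r ?mulrA.
Qed.

End SketchMatrix.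

Lemma Pr_good (x : R) : 1 - x <= 1 / 100 -> 99%:R / 100%:R <= x.
Proof. by lra. Qed.

Lemma sparse_lp_embedding (p : R) : Rle 1 p /\ Rlt p 2 ->
  exists c C : R, Rlt 0 c /\ Rlt 0 C /\
  forall d n : nat, (2 <= d)%coq_nat -> (1 <= n)%coq_nat ->
  exists r : nat, Rle (INR r) (Rmult C (pow (INR d) 2)) /\
  exists (S : prob_space) (Pi : S -> nat -> nat -> R),
    (forall i j, (i < r)%coq_nat -> (j < n)%coq_nat -> random_var S (fun w => Pi w i j)) /\
    (forall w, col_sparse2 r n (Pi w)) /\
    forall A : nat -> nat -> R,
      exists E : S -> Prop,
        ps_meas S E /\ Rle (Rdiv (IZR 99) (IZR 100)) (ps_P S E) /\
        forall w, E w ->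
        forall x : nat -> R,
          Rle (Rmult c (pnorm p n (mulmv d A x)))
            (pnorm p r (mulmv n (Pi w) (mulmv d A x))) /\
          Rle (pnorm p r (mulmv n (Pi w) (mulmv d A x)))
            (Rmult (Rmult C (Rpower (Rmult (INR d) (Rpower.ln (INR d))) (Rdiv 1 p)))
              (pnorm p n (mulmv d A x))).
Proof.
move=> [/RleP p1 /RltP p2].
have p0 : 0 < p by apply: lt_le_trans p1.
pose s := p / 2.
have s_ge : 2^-1 <= s by rewrite /s ler_peMl// invr_ge0.
have s_lt : s < 1 by rewrite /s ltr_pdivrMr ?mul1r ?ltr0n.
have [c [C [M [c0 C0 M0 main]]]] := oblivious_embedding s_ge s_lt.
pose Cr := (1200%:R ^+ 2 + M%:R : R)%R.
have Cr0 : 0 <= Cr by rewrite addr_ge0 ?exprn_ge0 ?ler0n.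
have cp0 : 0 < c `^ p^-1 by rewrite powR_gt0.
have Cp0 : 0 < C `^ p^-1 by rewrite powR_gt0.
(* One constant serves both claims: [Cr] bounds the rows, by [lg d <= d], and [C^(1/p)] the
   distortion. *)
exists (c `^ p^-1), (Cr + C `^ p^-1); split; first exact/RltP.
split; first by apply/RltP; rewrite ltr_wpDl.
move=> d n /ssrnat.leP d2 _.
have d_gt0 : (0 < d)%N by apply: leq_trans d2.
pose r1 := ((1200 * d) ^ 2)%N; pose r2 := (M * (d * lg d))%N.
exists (r1 + r2)%N; split.
  apply/RleP; rewrite INRE RmultE RpowE INRE.
  apply: (@le_trans _ _ (Cr * d%:R ^+ 2)); last first.
    by rewrite ler_wpM2r ?exprn_ge0// lerDl ltW.
  rewrite /r1 /r2 natrD natrX natrM exprMn mulrDl lerD2l natrM ler_wpM2l// natrM.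
  by rewrite expr2 ler_wpM2l// ler_nat lg_le.
have r2_gt0 : (0 < #|'I_r2|)%N by rewrite card_ord !muln_gt0 M0 d_gt0.
pose Om := fprod (fprod (hashes R n (block1_rows_gt0 d_gt0)) (signs R n)) (spread R n n r2_gt0).
exists (finite_prob_space Om), (fun w => sketch_matrix s w.1.1 w.1.2 w.2).
split; first by [].
split; first by move=> w; apply: sketch_matrix_sparse.
move=> A.
have := main d n d_gt0 r2_gt0 (fun i l => A i l) d2.
set good := (X in Pr _ (fun w => ~ X w)) => hgood.
exists good; split; first by [].
split.
  apply/RleP; rewrite RdivE !IZRposE !INRE.
  by apply: Pr_good; rewrite -Pr_not.
move=> w gw x; have /= := gw (fun l => x l).
have yE i : mulmv d A x i = \sum_(l < d) A i l * x l by rewrite /mulmv rsumE.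
rewrite !pnormE// sketch_matrix_mass.
have -> : (fun i : 'I_n => \sum_(l < d) A i l * x l) = (fun i : 'I_n => mulmv d A x i).
  by apply/funext => i; rewrite yE.
under eq_bigr do rewrite -yE.
set N := \sum_(i < n) _; set F := sketch_mass _ _ _ _ _.
have N0 : 0 <= N by apply: sumr_ge0 => i _; apply: pw_ge0.
have F0 : 0 <= F by apply: sketch_mass_ge0.
have ln0 : 0 <= ln (d%:R : R) by rewrite ln_ge0// ler1n.
have dln0 : 0 < d%:R * ln (d%:R : R) by rewrite mulr_gt0 ?ltr0n// ln_gt0// ltr1n.
have ip0 : 0 <= p^-1 by rewrite invr_ge0 ltW.
move=> [lo hi]; split; apply/RleP; rewrite !RmultE.
  rewrite -powRM ?(ltW c0)//; apply: ge0_ler_powR; rewrite ?nnegrE//.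
  by rewrite mulr_ge0// ltW.
rewrite INRE RlnE RpowerE// RdivE R1E div1r.
apply: (@le_trans _ _ (C `^ p^-1 * (d%:R * ln d%:R) `^ p^-1 * N `^ p^-1)); last first.
  by rewrite ler_wpM2r ?powR_ge0// ler_wpM2r ?powR_ge0// lerDr.
rewrite -powRM ?(ltW C0) ?(ltW dln0)// -powRM ?mulr_ge0 ?(ltW C0) ?(ltW dln0)//.
by apply: ge0_ler_powR; rewrite ?nnegrE// !mulr_ge0 ?(ltW C0).
Qed.

End SparseEmbedding.

Open Scope R_scope.

Theorem theorem5 :
  forall p : R, 1 <= p < 2 ->
  exists c C : R, 0 < c /\ 0 < C /\
  forall d n : nat, (2 <= d)%nat -> (1 <= n)%nat ->
  exists r : nat, INR r <= C * INR d ^ 2 /\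
  exists (S : prob_space) (Pi : S -> nat -> nat -> R),
    (forall i j, (i < r)%nat -> (j < n)%nat -> random_var S (fun w => Pi w i j)) /\
    (forall w, col_sparse2 r n (Pi w)) /\
    forall A : nat -> nat -> R,
      exists E : S -> Prop,
        ps_meas S E /\ 99 / 100 <= ps_P S E /\
        forall w, E w ->
        forall x : nat -> R,
          c * pnorm p n (mulmv d A x)
            <= pnorm p r (mulmv n (Pi w) (mulmv d A x)) /\
          pnorm p r (mulmv n (Pi w) (mulmv d A x))
            <= C * Rpower (INR d * ln (INR d)) (1 / p) * pnorm p n (mulmv d A x).
Proof. exact SparseEmbedding.sparse_lp_embedding. Qed.
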